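(* Let $\mathbb{T}$ be a geometric theory over a signature $\Sigma$. Then the non-contradictory quotients $\mathbb{T}'$ of $\mathbb{T}$ such that for every geometric sequent $\sigma$ over $\Sigma$ either $\sigma$ is provable in $\mathbb{T}'$ or the theory $\mathbb{T}'\cup\{\sigma\}$ is contradictory are exactly the quotients of $\mathbb{T}$ which are Boolean and complete.
   Context: Provability is in (infinitary) geometric logic. A quotient of $\mathbb{T}$ is a geometric theory over $\Sigma$ in which every axiom of $\mathbb{T}$ is provable. A geometric theory over $\Sigma$ is: contradictory if $\top\vdash_{[]}\bot$ is provable in it; Boolean if its classifying topos is a Boolean topos; complete if every geometric sentence over $\Sigma$ is provably equivalent in it to $\top$ or to $\bot$, but not both. *)

(* Defs.v *)
From mathcomp Require Import all_boot.
From Stdlib Require Import FunctionalExtensionality.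

Set Implicit Arguments.
Unset Strict Implicit.
Unset Printing Implicit Defensive.

(* The universe of "sets": signatures, index sets of disjunctions, and the
   values of sheaves all live in this one universe.  Geometric formulas form a
   large type, since disjunctions may be indexed by any set. *)
Definition SET := Type.

Record signature := Signature {
  sorts : SET;
  fsym : SET;
  fdom : fsym -> seq sorts;
  fcod : fsym -> sorts;
  rsym : SET;
  rdom : rsym -> seq sorts }.

(* A context is a finite list of sorts, its variables being de Bruijn indices;
   formulas-in-context are thus automatically identified up to renaming. *)
Definition ctx (Sg : signature) := seq (sorts Sg).

Inductive var (S : SET) : seq S -> S -> SET :=
| vz A G : var (A :: G) A
| vs A B G : var G A -> var (B :: G) A.
Arguments vz {S A G}.
Arguments vs {S A B G} _.

Definition vcase (S : SET) (P : S -> SET) (B : S) (G : seq S)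
    (p : P B) (f : forall A, var G A -> P A) (A : S) (v : var (B :: G) A) : P A :=
  match v in var G' A'
    return match G' with
           | [::] => unit
           | B' :: G0 => P B' -> (forall A, var G0 A -> P A) -> P A'
           end
  with
  | vz _ _ => fun p _ => p
  | vs _ _ _ w => fun _ f => f _ w
  end p f.

Fixpoint vl (S : SET) (D G : seq S) (A : S) (v : var D A) : var (D ++ G) A :=
  match v in var D' A' return var (D' ++ G) A' with
  | vz _ _ => vz
  | vs _ _ _ w => vs (vl G w)
  end.

Fixpoint vr (S : SET) (D G : seq S) (A : S) (v : var G A) : var (D ++ G) A :=
  match D with
  | [::] => v
  | B :: D' => vs (vr D' v)
  end.

Fixpoint vcat (S : SET) (P : S -> SET) (D G : seq S) :
    (forall A, var D A -> P A) -> (forall A, var G A -> P A) ->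
    forall A, var (D ++ G) A -> P A :=
  match D with
  | [::] => fun _ g => g
  | B :: D' => fun f g => vcase (f B vz) (vcat (fun A v => f A (vs v)) g)
  end.

(* The arguments of a symbol of domain D are a family of terms indexed by the
   variables of the context D. *)
Inductive term (Sg : signature) (G : ctx Sg) : sorts Sg -> SET :=
| Var A : var G A -> term G A
| App (f : fsym Sg) :
    (forall A, var (fdom f) A -> term G A) -> term G (fcod f).
Arguments Var {Sg G A} _.

Definition sub (Sg : signature) (G D : ctx Sg) := forall A, var G A -> term D A.

Fixpoint tsub (Sg : signature) (G D : ctx Sg) (s : sub G D) (A : sorts Sg)
    (t : term G A) : term D A :=
  match t with
  | Var _ v => s _ v
  | App f ts => App (fun B w => tsub s (ts B w))
  end.

Definition idsub (Sg : signature) (G : ctx Sg) : sub G G := fun A v => Var v.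
Arguments idsub {Sg G} A _.

Definition shift (Sg : signature) (B : sorts Sg) (G : ctx Sg) : sub G (B :: G) :=
  fun A v => Var (vs v).
Arguments shift {Sg B G} A _.

Definition inl_sub (Sg : signature) (D G : ctx Sg) : sub D (D ++ G) :=
  fun A v => Var (vl G v).
Arguments inl_sub {Sg} D G A _.

Definition inr_sub (Sg : signature) (D G : ctx Sg) : sub G (D ++ G) :=
  fun A v => Var (vr D v).
Arguments inr_sub {Sg} D G A _.

Definition scomp (Sg : signature) (G D E : ctx Sg) (t : sub D E) (s : sub G D) :
  sub G E := fun A v => tsub t (s A v).

Definition up (Sg : signature) (B : sorts Sg) (G D : ctx Sg) (s : sub G D) :
    sub (B :: G) (B :: D) :=
  vcase (Var vz) (scomp shift s).

Definition scons (Sg : signature) (B : sorts Sg) (G D : ctx Sg) (t : term D B)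
    (s : sub G D) : sub (B :: G) D :=
  vcase t s.

Inductive form (Sg : signature) : ctx Sg -> Type :=
| Rel G (R : rsym Sg) : (forall A, var (rdom R) A -> term G A) -> form G
| Eq G A : term G A -> term G A -> form G
| Top G : form G
| And G : form G -> form G -> form G
| Disj G (I : SET) : (I -> form G) -> form G
| Ex G A : form (A :: G) -> form G.
Arguments Top {Sg G}.

Definition Bot (Sg : signature) (G : ctx Sg) : form G :=
  Disj (fun i : Empty_set => match i with end).
Arguments Bot {Sg G}.

Fixpoint fsub (Sg : signature) (G : ctx Sg) (p : form G) :
    forall D, sub G D -> form D :=
  match p with
  | Rel _ _ ts => fun D s => Rel (fun B w => tsub s (ts B w))
  | Eq _ _ t u => fun D s => Eq (tsub s t) (tsub s u)
  | Top _ => fun D s => Top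
  | And _ p q => fun D s => And (fsub p s) (fsub q s)
  | Disj _ _ p => fun D s => Disj (fun i => fsub (p i) s)
  | Ex _ _ p => fun D s => Ex (fsub p (up s))
  end.

Record sequent (Sg : signature) := Sequent {
  sctx : ctx Sg;
  sleft : form sctx;
  sright : form sctx }.

Definition theory (Sg : signature) := sequent Sg -> Prop.

(* Infinitary geometric logic; prov T p q stands for the sequent p |-_G q.  A
   context may contain variables of possibly empty sorts, so there is no rule
   discarding unused variables. *)
Inductive prov (Sg : signature) (T : theory Sg) :
    forall G : ctx Sg, form G -> form G -> Prop :=
| p_ax s : T s -> prov T (sleft s) (sright s)
| p_id G (p : form G) : prov T p p
| p_sub G (p q : form G) D (s : sub G D) :
    prov T p q -> prov T (fsub p s) (fsub q s)
| p_cut G (p q r : form G) : prov T p q -> prov T q r -> prov T p r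
| p_refl G A (t : term G A) : prov T Top (Eq t t)
| p_leib G A (t u : term G A) (p : form (A :: G)) :
    prov T (And (Eq t u) (fsub p (scons t idsub))) (fsub p (scons u idsub))
| p_top G (p : form G) : prov T p Top
| p_andl G (p q : form G) : prov T (And p q) p
| p_andr G (p q : form G) : prov T (And p q) q
| p_and G (p q r : form G) : prov T p q -> prov T p r -> prov T p (And q r)
| p_inj G (I : SET) (p : I -> form G) i : prov T (p i) (Disj p)
| p_disj G (I : SET) (p : I -> form G) q :
    (forall i, prov T (p i) q) -> prov T (Disj p) q
| p_exl G A (p : form (A :: G)) (q : form G) :
    prov T p (fsub q shift) -> prov T (Ex p) q
| p_exr G A (p : form (A :: G)) (q : form G) :
    prov T (Ex p) q -> prov T p (fsub q shift)
| p_distr G (I : SET) (p : form G) (q : I -> form G) :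
    prov T (And p (Disj q)) (Disj (fun i => And p (q i)))
| p_frob G A (p : form G) (q : form (A :: G)) :
    prov T (And p (Ex q)) (Ex (And (fsub p shift) q)).

Definition provable (Sg : signature) (T : theory Sg) (s : sequent Sg) : Prop :=
  prov T (sleft s) (sright s).

Definition quotient (Sg : signature) (T T' : theory Sg) : Prop :=
  forall s, T s -> provable T' s.

Definition add_axiom (Sg : signature) (T : theory Sg) (s : sequent Sg) :
    theory Sg :=
  fun s' => T s' \/ s' = s.

Definition contradictory (Sg : signature) (T : theory Sg) : Prop :=
  prov T (G := [::]) Top Bot.

Definition prov_equiv (Sg : signature) (T : theory Sg) (G : ctx Sg)
    (p q : form G) : Prop :=
  prov T p q /\ prov T q p.

Definition complete (Sg : signature) (T : theory Sg) : Prop :=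
  forall p : form (Sg := Sg) [::],
    (prov_equiv T p Top \/ prov_equiv T p Bot) /\
    ~ (prov_equiv T p Top /\ prov_equiv T p Bot).

(* Hom-sets are given as types with an equivalence relation. *)
Record category := Category {
  obj :> Type;
  hom : obj -> obj -> Type;
  heq : forall x y, hom x y -> hom x y -> Prop;
  idm : forall x, hom x x;
  comp : forall x y z, hom y z -> hom x y -> hom x z;
  heq_refl : forall x y (f : hom x y), heq f f;
  heq_sym : forall x y (f g : hom x y), heq f g -> heq g f;
  heq_trans : forall x y (f g h : hom x y), heq f g -> heq g h -> heq f h;
  comp_heq : forall x y z (f f' : hom y z) (g g' : hom x y),
    heq f f' -> heq g g' -> heq (comp f g) (comp f' g');
  comp_idl : forall x y (f : hom x y), heq (comp (idm y) f) f;
  comp_idr : forall x y (f : hom x y), heq (comp f (idm x)) f;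
  comp_assoc : forall w x y z (f : hom y z) (g : hom x y) (h : hom w x),
    heq (comp f (comp g h)) (comp (comp f g) h) }.
Arguments idm {c} x.

Definition monic (C : category) (A E : C) (m : hom A E) : Prop :=
  forall X (f g : hom X A), heq (comp m f) (comp m g) -> heq f g.

Definition sub_le (C : category) (E A B : C) (m : hom A E) (n : hom B E) : Prop :=
  exists k : hom A B, heq (comp n k) m.

(* In the poset Sub(E), every lower bound of m and n is the least element and
   every upper bound is the greatest one: m /\ n = 0 and m \/ n = 1. *)
Definition complements (C : category) (E A B : C) (m : hom A E) (n : hom B E) :
    Prop :=
  (forall X (k : hom X E), monic k -> sub_le k m -> sub_le k n ->
     forall Y (l : hom Y E), monic l -> sub_le k l) /\
  (forall X (k : hom X E), monic k -> sub_le m k -> sub_le n k ->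
     forall Y (l : hom Y E), monic l -> sub_le l k).

(* For a topos: the (distributive) subobject lattices are Boolean algebras. *)
Definition boolean_topos (C : category) : Prop :=
  forall (E A : C) (m : hom A E), monic m ->
    exists (B : C) (n : hom B E), monic n /\ complements m n.

Record presheaf (C : category) := Presheaf {
  sec :> C -> SET;
  res : forall c d : C, hom d c -> sec c -> sec d;
  res_heq : forall (c d : C) (f g : hom d c) x, heq f g -> res f x = res g x;
  res_id : forall (c : C) (x : sec c), res (idm c) x = x;
  res_comp : forall (c d e : C) (f : hom d c) (g : hom e d) (x : sec c),
    res (comp f g) x = res g (res f x) }.

Record sieve (C : category) (c : C) := Sieve {
  arrows :> forall d : C, hom d c -> Prop;
  sieve_heq : forall (d : C) (f g : hom d c), heq f g -> arrows f -> arrows g;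
  sieve_comp : forall (d e : C) (f : hom d c) (g : hom e d),
    arrows f -> arrows (comp f g) }.

(* Taking g to be an identity, this includes independence of the proof of
   membership in S and invariance under equality of arrows. *)
Definition matching (C : category) (F : presheaf C) (c : C) (S : sieve c)
    (x : forall (d : C) (f : hom d c), S d f -> F d) : Prop :=
  forall (d e : C) (f : hom d c) (g : hom e d) (h : hom e c)
         (Sf : S d f) (Sh' : S e h),
    heq h (comp f g) -> x e h Sh' = res g (x d f Sf).

Definition is_sheaf (C : category) (J : forall c : C, sieve c -> Prop)
    (F : presheaf C) : Prop :=
  forall (c : C) (S : sieve c), J c S ->
  forall x : (forall (d : C) (f : hom d c), S d f -> F d), matching x ->
    exists! a : F c, forall (d : C) (f : hom d c) (Sf : S d f),
      res f a = x d f Sf.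

Record sheaf (C : category) (J : forall c : C, sieve c -> Prop) := Sheaf {
  sheaf_presheaf :> presheaf C;
  sheafP : is_sheaf J sheaf_presheaf }.

Record nat_trans (C : category) (F G : presheaf C) := NatTrans {
  component :> forall c : C, F c -> G c;
  naturality : forall (c d : C) (f : hom d c) (x : F c),
    component (res f x) = res f (component x) }.

Definition nat_id (C : category) (F : presheaf C) : nat_trans F F :=
  @NatTrans C F F (fun c x => x) (fun _ _ _ _ => erefl).

Definition nat_comp (C : category) (F G H : presheaf C) (a : nat_trans G H)
    (b : nat_trans F G) : nat_trans F H.
Proof.
exists (fun c x => a c (b c x)).
by move=> c d f x; rewrite !naturality.
Defined.

Definition Sh (C : category) (J : forall c : C, sieve c -> Prop) : category.
Proof.
apply: (@Category (sheaf J) (fun F G => nat_trans F G)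
  (fun F G a b => forall c x, a c x = b c x)
  (fun F => nat_id F) (fun F G H a b => nat_comp a b)) => //=.
- by move=> F G a b c eab ebc x y; rewrite eab.
- by move=> F G H a a' b b' ea eb c x; rewrite eb ea.
Defined.

Lemma sub_ext (Sg : signature) (G D : ctx Sg) (s t : sub G D) :
  (forall A v, s A v = t A v) -> s = t.
Proof.
move=> e; apply: functional_extensionality_dep => A.
by apply: functional_extensionality_dep => v.
Qed.

Lemma var_ind0 (S : SET) (B : S) (G : seq S) (P : forall A, var (B :: G) A -> Prop) :
  P B vz -> (forall A v, P A (vs v)) -> forall A v, P A v.
Proof.
move=> pz ps A v.
refine (match v as v' in var G' A' return
  match G' as G0 return var G0 A' -> Prop with
  | [::] => fun _ => True
  | B' :: G0 => fun v => forall Q : (forall A, var (B' :: G0) A -> Prop),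
      Q B' vz -> (forall A w, Q A (vs w)) -> Q A' v end v' with
  | vz _ _ => _ | vs _ _ _ w => _ end P pz ps).
- by move=> Q q _.
- by move=> Q _ q.
Qed.

Lemma vcat_vl (S : SET) (P : S -> SET) (D G : seq S)
    (f : forall A, var D A -> P A) (g : forall A, var G A -> P A) A (v : var D A) :
  vcat f g (vl G v) = f A v.
Proof. by elim: v f => [B D'|B B' D' w IH] f //=; rewrite IH. Qed.

Lemma vcat_vr (S : SET) (P : S -> SET) (D G : seq S)
    (f : forall A, var D A -> P A) (g : forall A, var G A -> P A) A (v : var G A) :
  vcat f g (vr D v) = g A v.
Proof. by elim: D f => [|B D IH] f //=; rewrite IH. Qed.

Lemma vcat_ind (S : SET) (D G : seq S) (P : forall A, var (D ++ G) A -> Prop) :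
  (forall A v, P A (vl G v)) -> (forall A v, P A (vr D v)) -> forall A v, P A v.
Proof.
elim: D P => [|B D IH] P hl hr A v; first exact: hr.
move: A v; apply: var_ind0; first exact: (hl _ vz).
by apply: IH => A v; [exact: (hl _ (vs v)) | exact: hr].
Qed.

Lemma tsub_comp (Sg : signature) (G D E : ctx Sg) (s : sub G D) (t : sub D E) A
    (u : term G A) : tsub t (tsub s u) = tsub (scomp t s) u.
Proof.
elim: u => [//|f ts IH] /=; congr App.
by apply: sub_ext => B v; rewrite IH.
Qed.

Lemma tsub_id (Sg : signature) (G : ctx Sg) A (u : term G A) : tsub idsub u = u.
Proof.
elim: u => [//|f ts IH] /=; congr App.
by apply: sub_ext => B v; rewrite IH.
Qed.

Lemma up_comp (Sg : signature) (B : sorts Sg) (G D E : ctx Sg) (s : sub G D)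
    (t : sub D E) : scomp (up (B := B) t) (up s) = up (scomp t s).
Proof.
by apply: sub_ext; apply: var_ind0 => // A v; rewrite /up /scomp /= !tsub_comp.
Qed.

Lemma up_id (Sg : signature) (B : sorts Sg) (G : ctx Sg) :
  up idsub = idsub :> sub (B :: G) (B :: G).
Proof. by apply: sub_ext; apply: var_ind0. Qed.

Lemma fsub_comp (Sg : signature) (G : ctx Sg) (p : form G) D E (s : sub G D)
    (t : sub D E) : fsub (fsub p s) t = fsub p (scomp t s).
Proof.
elim: p D E s t => //=.
- move=> G' R ts D E s t; congr Rel.
  by apply: sub_ext => B v; rewrite tsub_comp.
- by move=> G' A u v D E s t; rewrite !tsub_comp.
- by move=> G' p IHp q IHq D E s t; rewrite IHp IHq.
- move=> G' I p IH D E s t; congr Disj.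
  by apply: functional_extensionality_dep => i; rewrite IH.
- by move=> G' A p IH D E s t; rewrite IH up_comp.
Qed.

Lemma fsub_id (Sg : signature) (G : ctx Sg) (p : form G) : fsub p idsub = p.
Proof.
elim: p => //=.
- move=> G' R ts; congr Rel.
  by apply: sub_ext => B v; rewrite tsub_id.
- by move=> G' A u v; rewrite !tsub_id.
- by move=> G' p -> q ->.
- move=> G' I p IH; congr Disj.
  by apply: functional_extensionality_dep => i; rewrite IH.
- by move=> G' A p IH; rewrite up_id IH.
Qed.

Fixpoint Exs (Sg : signature) (D G : ctx Sg) : form (D ++ G) -> form G :=
  match D with
  | [::] => fun p => p
  | A :: D' => fun p => Exs (D := D') (Ex p)
  end.

Fixpoint Eqs (Sg : signature) (D G : ctx Sg) : sub D G -> sub D G -> form G :=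
  match D with
  | [::] => fun _ _ => Top
  | A :: D' => fun s t =>
      And (Eq (s A vz) (t A vz))
          (Eqs (D := D') (fun B v => s B (vs v)) (fun B v => t B (vs v)))
  end.

Lemma scompA (Sg : signature) (G D E F : ctx Sg) (s : sub G D) (t : sub D E)
    (u : sub E F) : scomp u (scomp t s) = scomp (scomp u t) s.
Proof. by apply: sub_ext => A v; rewrite /scomp tsub_comp. Qed.

Lemma scomp_idr (Sg : signature) (G D : ctx Sg) (s : sub G D) : scomp s idsub = s.
Proof. exact: sub_ext. Qed.

Lemma scomp_idl (Sg : signature) (G D : ctx Sg) (s : sub G D) : scomp idsub s = s.
Proof. by apply: sub_ext => A v; rewrite /scomp tsub_id. Qed.

Lemma scomp_vcat (Sg : signature) (D G E F : ctx Sg) (s : sub D E) (t : sub G E)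
    (u : sub E F) : scomp u (vcat s t) = vcat (scomp u s) (scomp u t).
Proof.
by apply: sub_ext; apply: vcat_ind => A v; rewrite /scomp ?vcat_vl ?vcat_vr.
Qed.

Lemma vcat_inl (Sg : signature) (D G E : ctx Sg) (s : sub D E) (t : sub G E) :
  scomp (vcat s t) (inl_sub D G) = s.
Proof. by apply: sub_ext => A v; rewrite /scomp /= vcat_vl. Qed.

Lemma vcat_inr (Sg : signature) (D G E : ctx Sg) (s : sub D E) (t : sub G E) :
  scomp (vcat s t) (inr_sub D G) = t.
Proof. by apply: sub_ext => A v; rewrite /scomp /= vcat_vr. Qed.

Lemma vcat_id (Sg : signature) (D G : ctx Sg) :
  vcat (inl_sub D G) (inr_sub D G) = idsub.
Proof. by apply: sub_ext; apply: vcat_ind => A v; rewrite ?vcat_vl ?vcat_vr. Qed.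

Definition subE := (fsub_comp, scomp_vcat, scompA, vcat_inl, vcat_inr, vcat_id,
  fsub_id, scomp_idl, scomp_idr).

Definition lift (Sg : signature) (D G E : ctx Sg) (s : sub G E) :
    sub (D ++ G) (D ++ E) :=
  vcat (inl_sub D E) (scomp (inr_sub D E) s).
Arguments lift {Sg} D {G E} s A _.

Lemma Exs_sub (Sg : signature) (D G E : ctx Sg) (p : form (D ++ G)) (s : sub G E) :
  fsub (Exs p) s = Exs (fsub p (lift D s)).
Proof.
elim: D p => [|A D IH] p /=.
  by congr fsub; apply: sub_ext => A v; rewrite /lift /= /scomp tsub_id.
rewrite IH /=; congr (Exs (Ex (fsub _ _))).
apply: sub_ext; apply: var_ind0 => // B v; rewrite /up /lift /=.
move: B v; apply: vcat_ind => B v; rewrite /scomp ?vcat_vl ?vcat_vr //.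
by rewrite tsub_comp.
Qed.

Lemma Eqs_sub (Sg : signature) (D G E : ctx Sg) (s t : sub D G) (u : sub G E) :
  fsub (Eqs s t) u = Eqs (scomp u s) (scomp u t).
Proof. by elim: D s t => [|A D IH] s t //=; rewrite IH. Qed.

Lemma Exs_frame (Sg : signature) (T : theory Sg) (D G : ctx Sg) (p : form (D ++ G))
    (q r : form G) :
  prov T (And (fsub q (inr_sub D G)) p) (fsub r (inr_sub D G)) ->
  prov T (And q (Exs p)) r.
Proof.
elim: D p => [|A D IH] p; first by rewrite !fsub_id.
move=> h /=; apply: IH; apply: p_cut (p_frob _ _ _) _.
by apply: p_exl; rewrite !fsub_comp.
Qed.

Lemma Exs_unit (Sg : signature) (T : theory Sg) (D G : ctx Sg) (p : form (D ++ G)) :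
  prov T p (fsub (Exs p) (inr_sub D G)).
Proof.
elim: D p => [|A D IH] p /=; first by rewrite fsub_id; exact: p_id.
apply: p_cut (p_exr (p_id _ _)) _.
by have := p_sub (@shift _ A _) (IH (Ex p)); rewrite fsub_comp.
Qed.

Lemma ExsI (Sg : signature) (T : theory Sg) (D G E : ctx Sg) (p : form (D ++ G))
    (r : form E) (s : sub G E) (u : sub D E) :
  prov T r (fsub p (vcat u s)) -> prov T r (fsub (Exs p) s).
Proof.
move=> h; apply: p_cut h _.
by have := p_sub (vcat u s) (Exs_unit T p); rewrite !subE.
Qed.

Lemma ExsE (Sg : signature) (T : theory Sg) (D G E : ctx Sg) (p : form (D ++ G))
    (r q : form E) (s : sub G E) :
  prov T r (fsub (Exs p) s) ->
  (forall r', prov T r' (fsub r (inr_sub D E)) -> prov T r' (fsub p (lift D s)) ->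
   prov T r' (fsub q (inr_sub D E))) ->
  prov T r q.
Proof.
rewrite Exs_sub => h k; apply: p_cut (p_and (p_id _ _) h) _.
by apply: Exs_frame; apply: k; [exact: p_andl | exact: p_andr].
Qed.

Lemma EqsP (Sg : signature) (T : theory Sg) (D G : ctx Sg) (r : form G)
    (s t : sub D G) :
  prov T r (Eqs s t) <-> forall A v, prov T r (Eq (s A v) (t A v)).
Proof.
elim: D s t => [|A D IH] s t /=.
  by split=> _; [move=> A v; inversion v | exact: p_top].
split=> [h|h].
  apply: var_ind0; first exact: p_cut h (p_andl _ _ _).
  by move=> B v; move/IH: (p_cut h (p_andr _ _ _)); apply.
by apply: p_and => //; apply/IH => B v.
Qed.

Lemma prov_leib (Sg : signature) (T : theory Sg) (G E : ctx Sg) (r : form E)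
    (s t : sub G E) (p : form G) :
  prov T r (Eqs s t) -> prov T r (fsub p s) -> prov T r (fsub p t).
Proof.
suff gen: forall q : form (G ++ E), prov T r (Eqs s t) ->
    prov T r (fsub q (vcat s idsub)) -> prov T r (fsub q (vcat t idsub)).
  by move=> e h; have := gen (fsub p (inl_sub G E)) e; rewrite !subE; apply.
elim: G s t {p} => [//|A G IH] s t q /= h hq.
have h1 := p_cut h (p_andl _ _ _); have h2 := p_cut h (p_andr _ _ _).
pose s' : sub G E := fun B v => s B (vs v); pose t' : sub G E := fun B v => t B (vs v).
pose a u : sub (A :: (G ++ E)) (G ++ E) := scons (tsub (inr_sub G E) u) idsub.
have aE (u : term E A) (w : sub G E) :
    scomp (vcat w idsub) (a u) = vcase u (vcat w idsub).
  apply: sub_ext; apply: var_ind0 => //=; rewrite {1}/scomp /= tsub_comp.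
  by rewrite vcat_inr tsub_id.
suff: prov T r (fsub q (vcase (t A vz) (vcat s' idsub))).
  by have := IH s' t' (fsub q (a (t A vz))) h2; rewrite !fsub_comp !aE.
pose q' := fsub q (vcase (Var vz) (scomp shift (vcat s' idsub)) : sub _ (A :: E)).
have qE u : fsub q' (scons u idsub) = fsub q (vcase u (vcat s' idsub)).
  rewrite /q' fsub_comp; congr fsub; apply: sub_ext; apply: var_ind0 => // B v.
  by rewrite /scomp /= tsub_comp -[RHS]tsub_id.
rewrite -qE; apply: p_cut (p_leib _ (s A vz) _ _).
by apply: p_and => //; rewrite qE.
Qed.

Lemma Eqs_refl (Sg : signature) (T : theory Sg) (D G : ctx Sg) (r : form G)
    (s : sub D G) : prov T r (Eqs s s).
Proof. by apply/EqsP => A v; apply: p_cut (p_top _ _) (p_refl _ _). Qed.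

Lemma Eqs_sym (Sg : signature) (T : theory Sg) (D G : ctx Sg) (r : form G)
    (s t : sub D G) : prov T r (Eqs s t) -> prov T r (Eqs t s).
Proof.
move=> h.
pose p : form (D ++ G) := Eqs (inl_sub D G) (scomp (inr_sub D G) s).
have -> : Eqs t s = fsub p (vcat t idsub) by rewrite Eqs_sub !subE.
apply: (prov_leib (s := vcat s idsub)); last first.
  by rewrite Eqs_sub !subE; exact: Eqs_refl.
apply/EqsP; apply: vcat_ind => A v; rewrite ?vcat_vl ?vcat_vr.
  by move/EqsP: h; apply.
exact: p_cut (p_top _ _) (p_refl _ _).
Qed.

Lemma Eqs_trans (Sg : signature) (T : theory Sg) (D G : ctx Sg) (r : form G)
    (s t u : sub D G) :
  prov T r (Eqs s t) -> prov T r (Eqs t u) -> prov T r (Eqs s u).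
Proof.
move=> h k.
pose p : form (D ++ G) := Eqs (scomp (inr_sub D G) s) (inl_sub D G).
have -> : Eqs s u = fsub p (vcat u idsub) by rewrite Eqs_sub !subE.
apply: (prov_leib (s := vcat t idsub)); last by rewrite Eqs_sub !subE.
apply/EqsP; apply: vcat_ind => A v; rewrite ?vcat_vl ?vcat_vr.
  by move/EqsP: k; apply.
exact: p_cut (p_top _ _) (p_refl _ _).
Qed.

Lemma Eqs_vcat (Sg : signature) (T : theory Sg) (D G E : ctx Sg) (r : form E)
    (s s' : sub D E) (t t' : sub G E) :
  prov T r (Eqs s s') -> prov T r (Eqs t t') ->
  prov T r (Eqs (vcat s t) (vcat s' t')).
Proof.
move=> /EqsP hs /EqsP ht; apply/EqsP.
by apply: vcat_ind => A v; rewrite ?vcat_vl ?vcat_vr.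
Qed.

Lemma prov_wk (Sg : signature) (T : theory Sg) (G E : ctx Sg) (r p : form G)
    (r' : form E) (s : sub G E) :
  prov T r' (fsub r s) -> prov T r p -> prov T r' (fsub p s).
Proof. by move=> h k; apply: p_cut h (p_sub _ k). Qed.

Record fobj (Sg : signature) := FObj { fctx : ctx Sg; fform : form fctx }.

(* An arrow {x. p} -> {y. q} is a formula g(y, x), in the context where the
   y's are listed first, which is T-provably functional from p to q:
   g |- p /\ q,   p |- (exists y) g,   g(y, x) /\ g(y', x) |- y = y'. *)
Record arrow (Sg : signature) (T : theory Sg) (X Y : fobj Sg) := Arrow {
  graph : form (fctx Y ++ fctx X);
  graph_sub : prov T graph
    (And (fsub (fform X) (inr_sub (fctx Y) (fctx X)))
         (fsub (fform Y) (inl_sub (fctx Y) (fctx X))));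
  graph_total : prov T (fform X) (Exs graph);
  graph_fun :
    let y := inl_sub (fctx Y) (fctx Y ++ fctx X) in
    let y' := scomp (inr_sub (fctx Y) (fctx Y ++ fctx X))
                    (inl_sub (fctx Y) (fctx X)) in
    let x := scomp (inr_sub (fctx Y) (fctx Y ++ fctx X))
                   (inr_sub (fctx Y) (fctx X)) in
    prov T (And (fsub graph (vcat y x)) (fsub graph (vcat y' x))) (Eqs y y') }.

Lemma graph_dom (Sg : signature) (T : theory Sg) (X Y : fobj Sg) (f : arrow T X Y)
    E (r : form E) (x : sub (fctx X) E) (y : sub (fctx Y) E) :
  prov T r (fsub (graph f) (vcat y x)) -> prov T r (fsub (fform X) x).
Proof.
move=> h; apply: p_cut h _.
by have := p_sub (vcat y x) (p_cut (graph_sub f) (p_andl _ _ _)); rewrite !subE.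
Qed.

Lemma graph_cod (Sg : signature) (T : theory Sg) (X Y : fobj Sg) (f : arrow T X Y)
    E (r : form E) (x : sub (fctx X) E) (y : sub (fctx Y) E) :
  prov T r (fsub (graph f) (vcat y x)) -> prov T r (fsub (fform Y) y).
Proof.
move=> h; apply: p_cut h _.
by have := p_sub (vcat y x) (p_cut (graph_sub f) (p_andr _ _ _)); rewrite !subE.
Qed.

Lemma graph_eq (Sg : signature) (T : theory Sg) (X Y : fobj Sg) (f : arrow T X Y)
    E (r : form E) (x : sub (fctx X) E) (y y' : sub (fctx Y) E) :
  prov T r (fsub (graph f) (vcat y x)) -> prov T r (fsub (graph f) (vcat y' x)) ->
  prov T r (Eqs y y').
Proof.
move=> h h'; apply: p_cut (p_and h h') _.
by have := p_sub (vcat y (vcat y' x)) (graph_fun f); rewrite /= Eqs_sub !subE.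
Qed.

Lemma graph_ex (Sg : signature) (T : theory Sg) (X Y : fobj Sg) (f : arrow T X Y)
    E (r q : form E) (x : sub (fctx X) E) :
  let w := inr_sub (fctx Y) E in
  let y := inl_sub (fctx Y) E in
  prov T r (fsub (fform X) x) ->
  (forall r', prov T r' (fsub r w) ->
   prov T r' (fsub (graph f) (vcat y (scomp w x))) ->
   prov T r' (fsub q w)) ->
  prov T r q.
Proof. by move=> w y h; apply: ExsE (prov_wk h (graph_total f)). Qed.

Definition comp_graph (Sg : signature) (X Y Z : ctx Sg) (g : form (Z ++ Y))
    (f : form (Y ++ X)) : form (Z ++ X) :=
  let y := inl_sub Y (Z ++ X) in
  let z := scomp (inr_sub Y (Z ++ X)) (inl_sub Z X) in
  let x := scomp (inr_sub Y (Z ++ X)) (inr_sub Z X) in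
  Exs (And (fsub f (vcat y x)) (fsub g (vcat z y))).

Lemma comp_graphI (Sg : signature) (T : theory Sg) (X Y Z E : ctx Sg)
    (g : form (Z ++ Y)) (f : form (Y ++ X)) (r : form E) x y z :
  prov T r (fsub f (vcat y x)) -> prov T r (fsub g (vcat z y)) ->
  prov T r (fsub (comp_graph g f) (vcat z x)).
Proof. by move=> hf hg; apply: (ExsI (u := y)); rewrite /= !subE; apply: p_and. Qed.

Lemma comp_graphE (Sg : signature) (T : theory Sg) (X Y Z E : ctx Sg)
    (g : form (Z ++ Y)) (f : form (Y ++ X)) (r q : form E) x z :
  prov T r (fsub (comp_graph g f) (vcat z x)) ->
  (let w := inr_sub Y E in
   let y := inl_sub Y E in
   forall r', prov T r' (fsub r w) ->
   prov T r' (fsub f (vcat y (scomp w x))) ->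
   prov T r' (fsub g (vcat (scomp w z) y)) ->
   prov T r' (fsub q w)) ->
  prov T r q.
Proof.
move=> h k; apply: ExsE h _ => r' h1; rewrite /= /lift !subE => h2.
apply: k => //; first exact: p_cut h2 (p_andl _ _ _).
exact: p_cut h2 (p_andr _ _ _).
Qed.

Lemma fsub_vcat_id (Sg : signature) (D G : ctx Sg) (p : form (D ++ G)) :
  fsub p (vcat (inl_sub D G) (inr_sub D G)) = p.
Proof. by rewrite vcat_id fsub_id. Qed.

Definition arrow_comp (Sg : signature) (T : theory Sg) (X Y Z : fobj Sg)
    (g : arrow T Y Z) (f : arrow T X Y) : arrow T X Z.
Proof.
exists (comp_graph (graph g) (graph f)).
- have h := p_id T (comp_graph (graph g) (graph f)).
  rewrite -{2}[comp_graph _ _]fsub_vcat_id in h.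
  apply: comp_graphE h _ => w y r' h hf hg /=; rewrite !subE.
  by apply: p_and; [exact: graph_dom hf | exact: graph_cod hg].
- have h := p_id T (fform X); rewrite -{2}[fform X]fsub_id in h.
  apply: (graph_ex (f := f) h) => r1 h1 hf.
  apply: (graph_ex (f := g) (graph_cod hf)) => r2 h2 hg.
  rewrite fsub_comp; apply: ExsI; apply: comp_graphI hg.
  by have := prov_wk h2 hf; rewrite !subE.
- move=> y y' x; apply: (comp_graphE (p_andl _ _ _)) => w v r' h1 hf hg.
  rewrite /= in h1; have {}h1 := p_cut h1 (p_andr _ _ _).
  rewrite fsub_comp scomp_vcat in h1.
  apply: (comp_graphE h1) => w' v' r2 h2 hf' hg'.
  have := prov_wk h2 hf; have := prov_wk h2 hg; rewrite !subE => {}hg {}hf.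
  rewrite !subE in hf' hg'.
  have e := graph_eq hf' hf.
  rewrite Eqs_sub; apply: (graph_eq hg).
  by apply: prov_leib hg'; apply: Eqs_vcat e; exact: Eqs_refl.
Defined.

Definition arrow_id (Sg : signature) (T : theory Sg) (X : fobj Sg) : arrow T X X.
Proof.
pose x := inr_sub (fctx X) (fctx X); pose x' := inl_sub (fctx X) (fctx X).
exists (And (fsub (fform X) x) (Eqs x' x)).
- apply: p_and; first exact: p_andl.
  by apply: (prov_leib (s := x)); [apply: Eqs_sym; exact: p_andr | exact: p_andl].
- rewrite -[Exs _]fsub_id; apply: (ExsI (u := idsub)).
  by rewrite /= Eqs_sub !subE; apply: p_and; [exact: p_id | exact: Eqs_refl].
- move=> y y' z /=; rewrite !Eqs_sub !subE.
  apply: (Eqs_trans (t := z)).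
    exact: p_cut (p_andl _ _ _) (p_andr _ _ _).
  by apply: Eqs_sym; exact: p_cut (p_andr _ _ _) (p_andr _ _ _).
Defined.

Lemma arrow_idP (Sg : signature) (T : theory Sg) (X : fobj Sg) E (r : form E)
    (x y : sub (fctx X) E) :
  prov T r (fsub (graph (arrow_id T X)) (vcat y x)) <->
  prov T r (fsub (fform X) x) /\ prov T r (Eqs y x).
Proof.
rewrite /= Eqs_sub !subE; split=> [h|[h1 h2]]; last exact: p_and.
by split; [exact: p_cut h (p_andl _ _ _) | exact: p_cut h (p_andr _ _ _)].
Qed.

Lemma graph_le (Sg : signature) (T : theory Sg) (X Y : ctx Sg) (p q : form (Y ++ X)) :
  (forall E (r : form E) x y, prov T r (fsub p (vcat y x)) ->
     prov T r (fsub q (vcat y x))) -> prov T p q.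
Proof.
by move=> h; rewrite -[q]fsub_vcat_id; apply: h; rewrite fsub_vcat_id; exact: p_id.
Qed.

Definition syn_cat (Sg : signature) (T : theory Sg) : category.
Proof.
apply: (@Category (fobj Sg) (arrow T)
  (fun X Y f g => prov_equiv T (graph f) (graph g))
  (arrow_id T) (@arrow_comp Sg T)).
- by move=> X Y f; split; exact: p_id.
- by move=> X Y f g [].
- by move=> X Y f g h [? ?] [? ?]; split; apply: p_cut; eassumption.
- have H X Y Z (f f' : arrow T Y Z) (g g' : arrow T X Y) :
      prov T (graph f) (graph f') -> prov T (graph g) (graph g') ->
      prov T (graph (arrow_comp f g)) (graph (arrow_comp f' g')).
    move=> hf hg; apply: graph_le => E r x z h.
    apply: comp_graphE h _ => w y r' h h1 h2; rewrite fsub_comp scomp_vcat.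
    by apply: comp_graphI; [exact: p_cut h1 (p_sub _ hg)
                           |exact: p_cut h2 (p_sub _ hf)].
  by move=> X Y Z f f' g g' [? ?] [? ?]; split; apply: H.
- move=> X Y f; split; apply: graph_le => E r x y h.
    apply: comp_graphE h _ => w z r' h h1 /arrow_idP [h2 h3].
    rewrite fsub_comp scomp_vcat; apply: prov_leib h1.
    by apply: Eqs_vcat (Eqs_refl _ _ _); exact: Eqs_sym.
  apply: comp_graphI (h) _; apply/arrow_idP.
  by split; [exact: graph_cod h | exact: Eqs_refl].
- move=> X Y f; split; apply: graph_le => E r x y h.
    apply: comp_graphE h _ => w z r' h /arrow_idP [h2 h3] h1.
    rewrite fsub_comp scomp_vcat; apply: prov_leib h1.
    exact: Eqs_vcat (Eqs_refl _ _ _) h3.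
  apply: comp_graphI (h); apply/arrow_idP.
  by split; [exact: graph_dom h | exact: Eqs_refl].
- move=> W X Y Z f g h; split; apply: graph_le => E r x z k.
    apply: comp_graphE k _ => w y r1 k1 k2 k3.
    apply: comp_graphE k2 _ => w' y' r2 k4 k5 k6.
    have := prov_wk k4 k3; rewrite !subE => {}k3; rewrite !subE in k5 k6.
    by apply: comp_graphI k5 _; apply: comp_graphI k6 k3.
  apply: comp_graphE k _ => w y r1 k1 k2 k3.
  apply: comp_graphE k3 _ => w' y' r2 k4 k5 k6.
  have := prov_wk k4 k2; rewrite !subE => {}k2; rewrite !subE in k5 k6.
  by apply: comp_graphI k6; apply: comp_graphI k2 k5.
Defined.

(* The image of g : {x. p} -> {y. q}, i.e. the formula (exists x) g in y. *)
Definition image (Sg : signature) (X Y : ctx Sg) (g : form (Y ++ X)) : form Y :=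
  Exs (fsub g (vcat (inr_sub X Y) (inl_sub X Y))).

(* J_T: the sieves containing a small family of arrows whose images T-provably
   cover the codomain. *)
Definition syn_top (Sg : signature) (T : theory Sg) (Y : syn_cat T) (S : sieve Y) :
    Prop :=
  exists (I : SET) (X : I -> syn_cat T) (f : forall i, hom (X i) Y),
    (forall i, S (X i) (f i)) /\
    prov T (fform Y) (Disj (fun i => image (graph (f i)))).

Definition classifying_topos (Sg : signature) (T : theory Sg) : category :=
  Sh (@syn_top Sg T).

Definition boolean_theory (Sg : signature) (T : theory Sg) : Prop :=
  boolean_topos (classifying_topos T).

(* Main.v *)
From mathcomp Require Import all_boot.
From Stdlib Require Import FunctionalExtensionality PropExtensionality.
From Stdlib Require Import ProofIrrelevance IndefiniteDescription.
Require Import Defs.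

Set Implicit Arguments.
Unset Strict Implicit.
Unset Printing Implicit Defensive.

(** If every sequent is provable or contradictory with [T'], then completeness is
    the deduction theorem for sentences.  Excluded middle for a formula [a], with
    [Neg a] the disjunction of the regular formulas inconsistent with [a], can be
    added to any theory without creating a contradiction (double negation), so
    [T'] proves it; a subsheaf [A] of [F] then has as complement the sections of
    [F] that no arrow from a non-empty object restricts into [A].

    Conversely, Booleanness applied to [true : 1 -> Omega] yields a complement
    [b] of [q] for each sequent [p |- q]; by completeness the sentence
    [exists x, p /\ b] is provably false, and then [p |- q] is provable, or
    provably true, and then adding [p |- q] is contradictory. *)

(** * Derived rules of geometric logic *)

Lemma prov_fst (Sg : signature) (T : theory Sg) (E : ctx Sg) (r p q : form E) :
  prov T r (And p q) -> prov T r p.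
Proof. by move=> h; apply: p_cut h (p_andl _ _ _). Qed.

Lemma prov_snd (Sg : signature) (T : theory Sg) (E : ctx Sg) (r p q : form E) :
  prov T r (And p q) -> prov T r q.
Proof. by move=> h; apply: p_cut h (p_andr _ _ _). Qed.

Lemma prov_top (Sg : signature) (T : theory Sg) (E : ctx Sg) (r p : form E) :
  prov T Top p -> prov T r p.
Proof. exact: p_cut (p_top _ _). Qed.

Lemma prov_disjE (Sg : signature) (T : theory Sg) (E : ctx Sg) (r q : form E)
    (I : SET) (p : I -> form E) :
  prov T r (Disj p) -> (forall i, prov T (And r (p i)) q) -> prov T r q.
Proof.
move=> h k; apply: p_cut (p_and (p_id _ r) h) _.
by apply: p_cut (p_distr _ _ _) _; apply: p_disj.
Qed.

Lemma prov_botE (Sg : signature) (T : theory Sg) (E : ctx Sg) (r q : form E) :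
  prov T r Bot -> prov T r q.
Proof. by move=> h; apply: prov_disjE h _; case. Qed.

Lemma fsub_bot (Sg : signature) (G D : ctx Sg) (s : sub G D) : fsub Bot s = Bot.
Proof. by rewrite /Bot /=; congr Disj; apply: functional_extensionality_dep; case. Qed.

Lemma prov_sub_bot (Sg : signature) (T : theory Sg) (G E : ctx Sg) (r : form E)
    (p : form G) (s : sub G E) :
  prov T r (fsub p s) -> prov T p Bot -> prov T r Bot.
Proof. by move=> h k; have := prov_wk h k; rewrite fsub_bot. Qed.

Definition Or (Sg : signature) (G : ctx Sg) (p q : form G) : form G :=
  Disj (fun b : bool => if b then p else q).

Lemma prov_orE (Sg : signature) (T : theory Sg) (E : ctx Sg) (r p q c : form E) :
  prov T r (Or p q) -> prov T (And r p) c -> prov T (And r q) c -> prov T r c.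
Proof. by move=> h hp hq; apply: prov_disjE h _; case. Qed.

Lemma prov_orl (Sg : signature) (T : theory Sg) (E : ctx Sg) (p q : form E) :
  prov T p (Or p q).
Proof. exact: (p_inj T (fun b : bool => if b then p else q) true). Qed.

Lemma prov_orr (Sg : signature) (T : theory Sg) (E : ctx Sg) (p q : form E) :
  prov T q (Or p q).
Proof. exact: (p_inj T (fun b : bool => if b then p else q) false). Qed.

Lemma Exs_le (Sg : signature) (T : theory Sg) (D G : ctx Sg) (p : form (D ++ G))
    (r : form G) :
  prov T p (fsub r (inr_sub D G)) -> prov T (Exs p) r.
Proof.
move=> h; apply: p_cut (p_and (p_top _ _) (p_id _ _)) _.
by apply: Exs_frame; apply: p_cut (p_andr _ _ _) h.
Qed.

(** * Regular formulas *)

(* Formulas without disjunctions form a small type, and every geometric formula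
   is the disjunction of the regular formulas below it: so the geometric
   formulas in a given context form a set up to provable equivalence. *)
Inductive reg (Sg : signature) : ctx Sg -> SET :=
| RRel G (R : rsym Sg) : (forall A, var (rdom R) A -> term G A) -> reg G
| REq G A : term G A -> term G A -> reg G
| RTop G : reg G
| RAnd G : reg G -> reg G -> reg G
| REx G A : reg (A :: G) -> reg G.
Arguments RTop {Sg G}.

Fixpoint emb (Sg : signature) (G : ctx Sg) (h : reg G) : form G :=
  match h with
  | RRel _ _ ts => Rel ts
  | REq _ _ t u => Eq t u
  | RTop _ => Top
  | RAnd _ h k => And (emb h) (emb k)
  | REx _ _ h => Ex (emb h)
  end.

Definition join (Sg : signature) (G : ctx Sg) (P : reg G -> Prop) : form G :=
  Disj (fun h : {h : reg G | P h} => emb (sval h)).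

Lemma join_ge (Sg : signature) (T : theory Sg) (G : ctx Sg) (P : reg G -> Prop) h :
  P h -> prov T (emb h) (join P).
Proof.
move=> Ph.
exact: (p_inj T (fun h : {h : reg G | P h} => emb (sval h)) (exist _ h Ph)).
Qed.
Arguments join_ge {Sg T G P h} _.

Lemma join_le (Sg : signature) (T : theory Sg) (G : ctx Sg) (P : reg G -> Prop)
    (p : form G) :
  (forall h, P h -> prov T (emb h) p) -> prov T (join P) p.
Proof. by move=> H; apply: p_disj => -[h Ph]; apply: H. Qed.

Lemma join_elim (Sg : signature) (T : theory Sg) (G : ctx Sg) (P : reg G -> Prop)
    (r p : form G) :
  prov T r (join P) -> (forall h, P h -> prov T (And r (emb h)) p) -> prov T r p.
Proof. by move=> h H; apply: prov_disjE h _ => -[h Ph]; apply: H. Qed.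

(** Induction on [p]. A conjunction uses distributivity twice, a disjunction collects the regular
    formulas of its disjuncts, and for [Ex p] each regular [h] below [p] lies below the weakening of
    [Ex h], which is regular and below [Ex p]. *)
Lemma reg_dense (Sg : signature) (T : theory Sg) (G : ctx Sg) (p : form G) :
  prov T p (join (fun h => prov T (emb h) p)).
Proof.
elim: p => {G}.
- by move=> G R ts; apply: (join_ge (h := RRel ts)); exact: p_id.
- by move=> G A t u; apply: (join_ge (h := REq t u)); exact: p_id.
- by move=> G; apply: (join_ge (h := RTop)); exact: p_id.
- move=> G p IHp q IHq.
  apply: (join_elim (p_cut (p_andl _ _ _) IHp)) => h hp.
  apply: (join_elim (p_cut (p_andl _ _ _) (p_cut (p_andr _ _ _) IHq))) => k kq.
  apply: (p_cut _ (join_ge (T := T) (h := RAnd h k) _)) => /=.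
    apply: p_and; last exact: p_andr.
    exact: p_cut (p_andl _ _ _) (p_andr _ _ _).
  by apply: p_and; [apply: p_cut (p_andl _ _ _) hp | apply: p_cut (p_andr _ _ _) kq].
- move=> G I p IH; apply: p_disj => i; apply: p_cut (IH i) _.
  by apply: join_le => h hp; apply: join_ge; apply: p_cut hp (p_inj _ _ _).
- move=> G A p IH; apply: p_exl; apply: p_cut IH _; apply: join_le => h hp.
  apply: (p_cut (p_exr (p_id _ (Ex (emb h))))).
  apply: p_sub; apply: (join_ge (h := REx h)) => /=.
  by apply: p_exl; apply: p_cut hp (p_exr (p_id _ _)).
Qed.

Lemma reg_le (Sg : signature) (T : theory Sg) (G : ctx Sg) (p q : form G) :
  (forall h, prov T (emb h) p -> prov T (emb h) q) -> prov T p q.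
Proof. by move=> H; apply: p_cut (reg_dense T p) _; apply: join_le. Qed.

(** The pseudo-complement of [p] modulo [T] within its own context. It need not commute with
    substitution, so excluded middle has to be studied in all contexts at once. *)
Definition Neg (Sg : signature) (T : theory Sg) (G : ctx Sg) (p : form G) : form G :=
  join (fun h => prov T (And (emb h) p) Bot).

(** Density reduces the claim to the regular formulas below [q], and each of these is a disjunct of
    [Neg T p]. *)
Lemma Neg_ge (Sg : signature) (T : theory Sg) (G : ctx Sg) (p q : form G) :
  prov T (And q p) Bot -> prov T q (Neg T p).
Proof.
move=> H; apply: reg_le => h hq; apply: join_ge.
apply: p_cut H; apply: p_and (p_andr _ _ _).
exact: p_cut (p_andl _ _ _) hq.
Qed.

(** * Adding axioms *)

Lemma prov_mono (Sg : signature) (T T' : theory Sg) (G : ctx Sg) (p q : form G) :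
  (forall s, T s -> T' s) -> prov T p q -> prov T' p q.
Proof.
move=> sTT'; elim => {G p q}.
- by move=> s /sTT' Ts; apply: p_ax.
- by move=> *; exact: p_id.
- by move=> *; exact: p_sub.
- by move=> G p q r _ h _ k; apply: p_cut h k.
- by move=> *; exact: p_refl.
- by move=> *; exact: p_leib.
- by move=> *; exact: p_top.
- by move=> *; exact: p_andl.
- by move=> *; exact: p_andr.
- by move=> *; exact: p_and.
- by move=> *; exact: p_inj.
- by move=> *; exact: p_disj.
- by move=> *; exact: p_exl.
- by move=> *; exact: p_exr.
- by move=> *; exact: p_distr.
- by move=> *; exact: p_frob.
Qed.

Definition nosub (Sg : signature) (G : ctx Sg) : sub [::] G :=
  fun A v => match v in var G' A' return
    match G' with [::] => term G A' | _ => unit end with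
    vz _ _ => tt | vs _ _ _ _ => tt end.

Lemma sub_nil (Sg : signature) (G : ctx Sg) (s t : sub [::] G) : s = t.
Proof. by apply: sub_ext => A v; inversion v. Qed.

(** Induction on derivations. The empty context has exactly one substitution into each context, so
    substitutions send weakenings of [a] to weakenings of [a]; this carries the hypothesis through
    [p_sub] and the two rules for [Ex]. *)
Lemma deduction (Sg : signature) (T : theory Sg) (a : form (Sg := Sg) [::])
    (G : ctx Sg) (p q : form G) :
  prov (add_axiom T (Sequent Top a)) p q ->
  prov T (And (fsub a (@nosub _ G)) p) q.
Proof.
have easy E (u v w : form E) : prov T v w -> prov T (And u v) w.
  by move=> h; apply: p_cut (p_andr _ _ _) h.
have aE E F (s : sub E F) : fsub (fsub a (@nosub _ E)) s = fsub a (@nosub _ F).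
  by rewrite fsub_comp; congr fsub; exact: sub_nil.
elim => {G p q}.
- move=> s [Ts|->] /=; first by apply: easy; exact: p_ax.
  by rewrite (sub_nil (@nosub _ _) idsub) fsub_id; exact: p_andl.
- by move=> *; exact: p_andr.
- by move=> G p q D s _ h; have := p_sub s h; rewrite /= aE.
- by move=> G p q r _ h _ k; apply: p_cut (p_and (p_andl _ _ _) h) k.
- by move=> *; apply: easy; exact: p_refl.
- by move=> *; apply: easy; exact: p_leib.
- by move=> *; exact: p_top.
- by move=> *; apply: easy; exact: p_andl.
- by move=> *; apply: easy; exact: p_andr.
- by move=> *; exact: p_and.
- by move=> *; apply: easy; exact: p_inj.
- move=> G I p q _ h; apply: (prov_disjE (p_andr _ _ _)) => i.
  apply: p_cut (h i); apply: p_and (p_andr _ _ _).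
  exact: p_cut (p_andl _ _ _) (p_andl _ _ _).
- move=> G A p q _ h; apply: p_cut (p_frob _ _ _) _.
  by apply: p_exl; rewrite aE.
- move=> G A p q _ h.
  have := p_sub (@shift _ A _) h; rewrite /= aE; apply: p_cut.
  by apply: p_and (p_andl _ _ _) _; apply: easy; exact: p_exr (p_id _ _).
- by move=> *; apply: easy; exact: p_distr.
- by move=> *; apply: easy; exact: p_frob.
Qed.

(* [p] is below the double negation of [q], stably under substitution. *)
Definition nnle (Sg : signature) (T : theory Sg) (G : ctx Sg) (p q : form G) :=
  forall D (s : sub G D) (r : form D),
    prov T (And r (fsub q s)) Bot -> prov T (And r (fsub p s)) Bot.

Lemma prov_nnle (Sg : signature) (T : theory Sg) (G : ctx Sg) (p q : form G) :
  prov T p q -> nnle T p q.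
Proof.
move=> h D s r; apply: p_cut; apply: p_and (p_andl _ _ _) _.
exact: p_cut (p_andr _ _ _) (p_sub _ h).
Qed.

Lemma lem_nnle (Sg : signature) (T : theory Sg) (G : ctx Sg) (a : form G) :
  nnle T Top (Or a (Neg T a)).
Proof.
move=> D s r h.
have ra : prov T (And r (fsub a s)) Bot.
  apply: p_cut h; apply: p_and (p_andl _ _ _) _.
  exact: p_cut (p_andr _ _ _) (p_sub _ (prov_orl _ _ _)).
(* [r'] is the image of [r] along [s]: some point of [D] satisfies [r] and is sent by [s] to the
   given point of [G]. It is inconsistent with [a], hence below [Neg T a]; pulling back along [s]
   puts [r] below the second disjunct, so [r] is itself inconsistent. *)
pose r' : form G :=
  Exs (And (fsub r (inl_sub D G)) (Eqs (scomp (inl_sub D G) s) (inr_sub D G))).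
have r'N : prov T r' (Neg T a).
  apply: Neg_ge.
  apply: (ExsE (s := idsub) (p := And (fsub r (inl_sub D G))
     (Eqs (scomp (inl_sub D G) s) (inr_sub D G)))).
    by rewrite fsub_id; exact: p_andl.
  move=> t h1 h2; rewrite fsub_bot; rewrite /= in h1 h2.
  rewrite Eqs_sub /lift !subE in h2.
  have := prov_wk (r := And r (fsub a s)) (s := inl_sub D G) _ ra.
  rewrite fsub_bot; apply; rewrite /= fsub_comp; apply: p_and.
    exact: prov_fst h2.
  apply: prov_leib (Eqs_sym (prov_snd h2)) _; exact: prov_snd h1.
apply: p_cut h; apply: p_and (p_andl _ _ _) _.
apply: p_cut (p_andl _ _ _) _; apply: p_cut (p_sub _ (prov_orr _ _ _)).
apply: (prov_wk (r := r')) r'N.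
apply: (ExsI (u := idsub)); rewrite /= Eqs_sub !subE.
by apply: p_and (p_id _ _) _; exact: Eqs_refl.
Qed.

(** Every rule preserves [nnle], and the new axiom satisfies it by [lem_nnle]. With [Bot] for [q],
    this shows that a contradiction from excluded middle is already one in [T]. *)
Lemma lem_conservative (Sg : signature) (T : theory Sg) (B : ctx Sg) (a : form B)
    (G : ctx Sg) (p q : form G) :
  prov (add_axiom T (Sequent Top (Or a (Neg T a)))) p q -> nnle T p q.
Proof.
elim => {G p q}.
- move=> s [Ts|->]; last exact: lem_nnle.
  by apply: prov_nnle; exact: p_ax.
- by move=> *; apply: prov_nnle; exact: p_id.
- by move=> G p q D s _ h E u r; rewrite !fsub_comp; exact: h.
- by move=> G p q r _ h _ k D s u /k /h.
- by move=> *; apply: prov_nnle; exact: p_refl.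
- by move=> *; apply: prov_nnle; exact: p_leib.
- by move=> *; apply: prov_nnle; exact: p_top.
- by move=> *; apply: prov_nnle; exact: p_andl.
- by move=> *; apply: prov_nnle; exact: p_andr.
- move=> G p q r _ hq _ hr D s u /= h.
  (* The conjuncts are replaced by [p] one at a time, the other being absorbed into the side
     formula. *)
  have: prov T (And (And u (fsub q s)) (fsub r s)) Bot.
    apply: p_cut h; apply: p_and.
      exact: p_cut (p_andl _ _ _) (p_andl _ _ _).
    apply: p_and (p_andr _ _ _); exact: p_cut (p_andl _ _ _) (p_andr _ _ _).
  move/hr => {}h.
  have: prov T (And (And u (fsub p s)) (fsub q s)) Bot.
    apply: p_cut h; apply: p_and.
      apply: p_and (p_andr _ _ _); exact: p_cut (p_andl _ _ _) (p_andl _ _ _).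
    exact: p_cut (p_andl _ _ _) (p_andr _ _ _).
  move/hq; apply: p_cut; apply: p_and (p_id _ _) (p_andr _ _ _).
- by move=> *; apply: prov_nnle; exact: p_inj.
- move=> G I p q _ h D s r k /=; apply: p_cut (p_distr _ _ _) _.
  by apply: p_disj => i; exact: h.
- move=> G A p q _ h D s r k /=; apply: p_cut (p_frob _ _ _) _.
  apply: p_exl; rewrite fsub_bot; apply: h.
  have := p_sub (@shift _ A _) k; rewrite fsub_bot /= !fsub_comp.
  by congr (prov T (And _ (fsub q _)) _); exact: sub_ext.
- move=> G A p q _ h D s r; rewrite fsub_comp => /h; apply: p_cut.
  apply: p_and (p_andl _ _ _) _; apply: p_cut (p_andr _ _ _) _.
  by have := p_sub s (p_exr (p_id T (Ex p))); rewrite fsub_comp.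
- by move=> *; apply: prov_nnle; exact: p_distr.
- by move=> *; apply: prov_nnle; exact: p_frob.
Qed.

(** * The syntactic site *)

Lemma imageI (Sg : signature) (T : theory Sg) (X Y E : ctx Sg) (g : form (Y ++ X))
    (r : form E) (y : sub Y E) (x : sub X E) :
  prov T r (fsub g (vcat y x)) -> prov T r (fsub (image g) y).
Proof. by move=> h; apply: (ExsI (u := x)); rewrite !subE. Qed.

Lemma imageE (Sg : signature) (T : theory Sg) (X Y E : ctx Sg) (g : form (Y ++ X))
    (r q : form E) (y : sub Y E) :
  let w := inr_sub X E in
  prov T r (fsub (image g) y) ->
  (forall r', prov T r' (fsub r w) ->
   prov T r' (fsub g (vcat (scomp w y) (inl_sub X E))) ->
   prov T r' (fsub q w)) ->
  prov T r q.
Proof.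
move=> w h k; apply: ExsE h _ => r' h1; rewrite /lift !subE => h2.
exact: k.
Qed.

Lemma form_le (Sg : signature) (T : theory Sg) (X : ctx Sg) (p q : form X) :
  (forall E (r : form E) (x : sub X E),
     prov T r (fsub p x) -> prov T r (fsub q x)) -> prov T p q.
Proof.
by move=> h; rewrite -[q]fsub_id; apply: h; rewrite fsub_id; exact: p_id.
Qed.

(** * Arrows given by terms, and fibre products *)

Definition term_arrow (Sg : signature) (T : theory Sg) (X Y : fobj Sg)
    (s : sub (fctx Y) (fctx X)) (h : prov T (fform X) (fsub (fform Y) s)) :
  arrow T X Y.
Proof.
pose x := inr_sub (fctx Y) (fctx X); pose y := inl_sub (fctx Y) (fctx X).
exists (And (fsub (fform X) x) (Eqs y (scomp x s))).
- apply: p_and; first exact: p_andl.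
  apply: (prov_leib (s := scomp x s)); first by apply: Eqs_sym; exact: p_andr.
  by rewrite -fsub_comp; apply: p_cut (p_andl _ _ _) (p_sub _ h).
- rewrite -[Exs _]fsub_id; apply: (ExsI (u := s)).
  by rewrite /= Eqs_sub !subE; apply: p_and; [exact: p_id | exact: Eqs_refl].
- move=> z z' t /=; rewrite !Eqs_sub !subE.
  apply: (Eqs_trans (t := scomp t s)).
    exact: p_cut (p_andl _ _ _) (p_andr _ _ _).
  by apply: Eqs_sym; exact: p_cut (p_andr _ _ _) (p_andr _ _ _).
Defined.

Lemma term_arrowP (Sg : signature) (T : theory Sg) (X Y : fobj Sg)
    (s : sub (fctx Y) (fctx X)) (h : prov T (fform X) (fsub (fform Y) s))
    E (r : form E) (x : sub (fctx X) E) (y : sub (fctx Y) E) :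
  prov T r (fsub (graph (term_arrow h)) (vcat y x)) <->
  prov T r (fsub (fform X) x) /\ prov T r (Eqs y (scomp x s)).
Proof.
rewrite /= Eqs_sub !subE; split=> [k|[h1 h2]]; last exact: p_and.
by split; [exact: prov_fst k | exact: prov_snd k].
Qed.

(** The fibre product of [f] and [g]: pairs [(x, y)] with a common value [z], which is quantified
    away. *)
Definition pb_obj (Sg : signature) (T : theory Sg) (X Y Z : fobj Sg)
    (f : arrow T X Z) (g : arrow T Y Z) : fobj Sg :=
  let w := inr_sub (fctx Z) (fctx X ++ fctx Y) in
  let z := inl_sub (fctx Z) (fctx X ++ fctx Y) in
  FObj (Exs (And
    (fsub (graph f) (vcat z (scomp w (inl_sub (fctx X) (fctx Y)))))
    (fsub (graph g) (vcat z (scomp w (inr_sub (fctx X) (fctx Y))))))).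

Lemma pb_objI (Sg : signature) (T : theory Sg) (X Y Z : fobj Sg)
    (f : arrow T X Z) (g : arrow T Y Z) E (r : form E) x y z :
  prov T r (fsub (graph f) (vcat z x)) -> prov T r (fsub (graph g) (vcat z y)) ->
  prov T r (fsub (fform (pb_obj f g)) (vcat x y)).
Proof. by move=> hf hg; apply: (ExsI (u := z)); rewrite /= !subE; exact: p_and. Qed.

Lemma pb_objE (Sg : signature) (T : theory Sg) (X Y Z : fobj Sg)
    (f : arrow T X Z) (g : arrow T Y Z) E (r q : form E)
    (v : sub (fctx X ++ fctx Y) E) :
  let w := inr_sub (fctx Z) E in
  let z := inl_sub (fctx Z) E in
  prov T r (fsub (fform (pb_obj f g)) v) ->
  (forall r', prov T r' (fsub r w) ->
   prov T r' (fsub (graph f)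
     (vcat z (scomp w (scomp v (inl_sub (fctx X) (fctx Y)))))) ->
   prov T r' (fsub (graph g)
     (vcat z (scomp w (scomp v (inr_sub (fctx X) (fctx Y)))))) ->
   prov T r' (fsub q w)) ->
  prov T r q.
Proof.
move=> w z h k; apply: ExsE h _ => r' h1; rewrite /= /lift !subE => h2.
apply: k => //; rewrite !subE; [exact: prov_fst h2 | exact: prov_snd h2].
Qed.

Lemma pb_dom1 (Sg : signature) (T : theory Sg) (X Y Z : fobj Sg)
    (f : arrow T X Z) (g : arrow T Y Z) :
  prov T (fform (pb_obj f g)) (fsub (fform X) (inl_sub (fctx X) (fctx Y))).
Proof.
have h := p_id T (fform (pb_obj f g)); rewrite -{2}[fform _]fsub_id in h.
apply: (pb_objE h) => r' h1 h2 h3; rewrite fsub_comp.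
by have := graph_dom h2; rewrite !subE.
Qed.

Lemma pb_dom2 (Sg : signature) (T : theory Sg) (X Y Z : fobj Sg)
    (f : arrow T X Z) (g : arrow T Y Z) :
  prov T (fform (pb_obj f g)) (fsub (fform Y) (inr_sub (fctx X) (fctx Y))).
Proof.
have h := p_id T (fform (pb_obj f g)); rewrite -{2}[fform _]fsub_id in h.
apply: (pb_objE h) => r' h1 h2 h3; rewrite fsub_comp.
by have := graph_dom h3; rewrite !subE.
Qed.

Definition pb_fst (Sg : signature) (T : theory Sg) (X Y Z : fobj Sg)
    (f : arrow T X Z) (g : arrow T Y Z) : arrow T (pb_obj f g) X :=
  term_arrow (Y := X) (pb_dom1 f g).

Definition pb_snd (Sg : signature) (T : theory Sg) (X Y Z : fobj Sg)
    (f : arrow T X Z) (g : arrow T Y Z) : arrow T (pb_obj f g) Y :=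
  term_arrow (Y := Y) (pb_dom2 f g).

Lemma graph_subst (Sg : signature) (T : theory Sg) (X Y : fobj Sg) (f : arrow T X Y)
    E (r : form E) (x x' : sub (fctx X) E) (y y' : sub (fctx Y) E) :
  prov T r (Eqs y y') -> prov T r (Eqs x x') ->
  prov T r (fsub (graph f) (vcat y x)) -> prov T r (fsub (graph f) (vcat y' x')).
Proof. by move=> hy hx; apply: prov_leib; apply: Eqs_vcat. Qed.

Lemma comp_term_arrowP (Sg : signature) (T : theory Sg) (X Y Z : fobj Sg)
    (f : arrow T Y Z)
    (s : sub (fctx Y) (fctx X)) (h : prov T (fform X) (fsub (fform Y) s))
    E (r : form E) (x : sub (fctx X) E) (z : sub (fctx Z) E) :
  prov T r (fsub (graph (arrow_comp f (term_arrow h))) (vcat z x)) <->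
  prov T r (fsub (fform X) x) /\ prov T r (fsub (graph f) (vcat z (scomp x s))).
Proof.
split=> [k|[h1 h2]]; last first.
  by apply: comp_graphI h2; apply/term_arrowP; split=> //; exact: Eqs_refl.
split; first exact: graph_dom k.
apply: comp_graphE k _ => w y r' k1 /term_arrowP [k2 k3] k4.
rewrite fsub_comp scomp_vcat; apply: graph_subst k4; first exact: Eqs_refl.
by rewrite !subE in k3 *.
Qed.

Lemma pb_comm (Sg : signature) (T : theory Sg) (X Y Z : syn_cat T)
    (f : hom X Z) (g : hom Y Z) :
  heq (comp f (pb_fst f g : hom (pb_obj f g : syn_cat T) X))
      (comp g (pb_snd f g : hom (pb_obj f g : syn_cat T) Y)).
Proof.
split; apply: graph_le => E r v z /comp_term_arrowP [h1 h2];
  apply/comp_term_arrowP; split=> //; apply: (pb_objE h1) => r' h3 h4 h5;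
  have := prov_wk h3 h2; rewrite fsub_comp scomp_vcat => h6;
  rewrite fsub_comp scomp_vcat.
- exact: graph_subst (graph_eq h4 h6) (Eqs_refl _ _ _) h5.
- exact: graph_subst (graph_eq h5 h6) (Eqs_refl _ _ _) h4.
Qed.

(* The union of the images of the arrows of a sieve, which is again a geometric
   formula although the sieve is large. *)
Definition img (Sg : signature) (T : theory Sg) (Y : syn_cat T) (S : sieve Y) :
    form (fctx Y) :=
  join (fun h => exists (X : syn_cat T) (f : hom X Y),
    S X f /\ prov T (emb h) (image (graph f))).

Lemma img_ge (Sg : signature) (T : theory Sg) (Y : syn_cat T) (S : sieve Y)
    (X : syn_cat T) (f : hom X Y) :
  S X f -> prov T (image (graph f)) (img S).
Proof.
by move=> Sf; apply: reg_le => h hf; apply: join_ge; exists X, f.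
Qed.

Lemma img_le (Sg : signature) (T : theory Sg) (Y : syn_cat T) (S : sieve Y) q :
  (forall (X : syn_cat T) (f : hom X Y), S X f -> prov T (image (graph f)) q) ->
  prov T (img S) q.
Proof.
by move=> H; apply: join_le => h [X [f [Sf hf]]]; apply: p_cut hf (H _ _ Sf).
Qed.

(** A sieve is large, but [img S] is a disjunction over a small type of regular formulas. Choosing
    for each of them an arrow of [S] whose image lies above it yields the small covering family. *)
Lemma syn_topP (Sg : signature) (T : theory Sg) (Y : syn_cat T) (S : sieve Y) :
  syn_top S <-> prov T (fform Y) (img S).
Proof.
split=> [[I [X [f [Sf hf]]]]|h].
  by apply: p_cut hf _; apply: p_disj => i; apply: img_ge.
pose P (h : reg (fctx Y)) := exists (X : syn_cat T) (f : hom X Y),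
    S X f /\ prov T (emb h) (image (graph f)).
have /functional_choice [a aP] : forall h : {h | P h},
    exists u : {X : syn_cat T & hom X Y},
    S _ (projT2 u) /\ prov T (emb (sval h)) (image (graph (projT2 u))).
  by move=> [k [X [f Sf]]]; exists (existT _ X f).
exists {h | P h}, (fun i => projT1 (a i)), (fun i => projT2 (a i)).
split=> [i|]; first by case: (aP i).
apply: p_cut h _; apply: p_disj => i; apply: p_cut (proj2 (aP i)) _.
exact: (p_inj T (fun i => image (graph (projT2 (a i))))).
Qed.

Lemma cover_le (Sg : signature) (T : theory Sg) (Y : syn_cat T) (S : sieve Y) q :
  syn_top S ->
  (forall (X : syn_cat T) (f : hom X Y), S X f -> prov T (image (graph f)) q) ->
  prov T (fform Y) q.
Proof. by move=> /syn_topP h H; apply: p_cut h (img_le H). Qed.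

(** * Stability and transitivity of covers *)

Definition pull_sieve (C : category) (c d : C) (g : hom d c) (S : sieve c) : sieve d.
Proof.
exists (fun e (f : hom e d) => S e (comp g f)).
- by move=> e f f' ff'; apply: sieve_heq; apply: comp_heq ff'; exact: heq_refl.
- move=> e e' f f' Sf; apply: sieve_heq (sieve_comp f' Sf).
  by apply: heq_sym; exact: comp_assoc.
Defined.

(** A point of [img S] may be treated as a value [f x] with [f] in [S], at the price of moving along
    [w] to another context [E']. *)
Lemma img_elim (Sg : signature) (T : theory Sg) (Y : syn_cat T) (S : sieve Y)
    E (r q : form E) (y : sub (fctx Y) E) :
  prov T r (fsub (img S) y) ->
  (forall (X : syn_cat T) (f : hom X Y) E' (r' : form E') (w : sub E E')
     (x : sub (fctx X) E'), S X f -> prov T r' (fsub r w) ->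
     prov T r' (fsub (graph f) (vcat (scomp w y) x)) -> prov T r' (fsub q w)) ->
  prov T r q.
Proof.
move=> h H; apply: (prov_disjE h) => -[k [X [f [Sf hk]]]] /=.
apply: (imageE (prov_wk (p_andr _ _ _) hk)) => r' h1 h2.
apply: H Sf _ h2; rewrite /= in h1; exact: prov_fst h1.
Qed.

Lemma img_intro (Sg : signature) (T : theory Sg) (Y : syn_cat T) (S : sieve Y)
    (X : syn_cat T) (f : hom X Y) E (r : form E) (y : sub (fctx Y) E) x :
  S X f -> prov T r (fsub (graph f) (vcat y x)) -> prov T r (fsub (img S) y).
Proof. by move=> Sf h; apply: prov_wk (imageI h) (img_ge Sf). Qed.

Lemma syn_top_pull (Sg : signature) (T : theory Sg) (X Y : syn_cat T)
    (g : hom X Y) (S : sieve Y) :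
  syn_top S -> syn_top (pull_sieve g S).
Proof.
move=> /syn_topP SY; apply/syn_topP; apply: form_le => E r x hx.
apply: (graph_ex (f := g) hx) => r1 h1 h2.
apply: (img_elim (prov_wk (graph_cod h2) SY)) => Z f E2 r2 w z Sf h3 h4.
have := prov_wk h3 h2; rewrite !subE in h4 * => h5.
(* Here [g x] is also the value of [f] at [z], so [(x, z)] is a point of the fibre product. Its
   projection to [X] is in the pulled-back sieve, since following it by [g] gives an arrow that
   factors through [f]. *)
apply: (img_intro (f := pb_fst g f : hom (pb_obj g f : syn_cat T) X)
                  (x := vcat (scomp (scomp w (inr_sub _ _)) x) z)).
  by apply: sieve_heq (sieve_comp _ Sf); apply: heq_sym; exact: pb_comm.
apply/term_arrowP; rewrite !subE; split; last exact: Eqs_refl.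
exact: pb_objI h5 h4.
Qed.

Lemma syn_top_trans (Sg : signature) (T : theory Sg) (Y : syn_cat T)
    (S R : sieve Y) :
  syn_top S ->
  (forall (X : syn_cat T) (f : hom X Y), S X f -> syn_top (pull_sieve f R)) ->
  syn_top R.
Proof.
move=> /syn_topP SY H; apply/syn_topP; apply: form_le => E r y hy.
apply: (img_elim (prov_wk hy SY)) => X f E1 r1 w x Sf h1 h2.
have /syn_topP RX := H _ _ Sf.
apply: (img_elim (prov_wk (graph_dom h2) RX)) => Z g E2 r2 v z Rg h3 h4.
have := prov_wk h3 h2; rewrite !subE => h5.
apply: (img_intro (S := R) (f := comp f g) Rg); exact: comp_graphI h4 h5.
Qed.

Lemma syn_top_mono (Sg : signature) (T : theory Sg) (Y : syn_cat T)
    (S R : sieve Y) :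
  (forall (X : syn_cat T) (f : hom X Y), S X f -> R X f) -> syn_top S -> syn_top R.
Proof.
by move=> SR [I [X [f [Sf hf]]]]; exists I, X, f; split=> // i; apply: SR.
Qed.

Lemma syn_top_id (Sg : signature) (T : theory Sg) (Y : syn_cat T) (S : sieve Y) :
  S Y (idm Y) -> syn_top S.
Proof.
move=> SY; apply/syn_topP; apply: form_le => E r y hy.
apply: (img_intro SY (x := y)); apply/arrow_idP; split=> //; exact: Eqs_refl.
Qed.

Lemma syn_top_bot (Sg : signature) (T : theory Sg) (Y : syn_cat T) (S : sieve Y) :
  prov T (fform Y) Bot -> syn_top S.
Proof. by move=> h; apply/syn_topP; exact: prov_botE. Qed.

Lemma arrow_bot (Sg : signature) (T : theory Sg) (X Y : syn_cat T) (f : hom X Y) :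
  prov T (fform Y) Bot -> prov T (fform X) Bot.
Proof.
move=> h; have hx := p_id T (fform X); rewrite -{2}[fform X]fsub_id in hx.
apply: (graph_ex (f := f) hx) => r h1 h2; rewrite fsub_bot.
exact: prov_sub_bot (graph_cod h2) h.
Qed.

Lemma cover_bot (Sg : signature) (T : theory Sg) (Y : syn_cat T) (S : sieve Y) :
  syn_top S ->
  (forall (X : syn_cat T) (f : hom X Y), S X f -> prov T (fform X) Bot) ->
  prov T (fform Y) Bot.
Proof.
move=> SY H; apply: (cover_le SY) => X f Sf; rewrite -[image _]fsub_id.
apply: (imageE (p_id _ _)) => r _ h; rewrite fsub_bot.
exact: prov_sub_bot (graph_dom h) (H _ _ Sf).
Qed.

(** * Subsheaves *)

Lemma sheaf_sep (C : category) (J : forall c : C, sieve c -> Prop) (F : sheaf J)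
    (c : C) (S : sieve c) (a b : F c) :
  J c S -> (forall d (f : hom d c), S d f -> res f a = res f b) -> a = b.
Proof.
move=> JS ab.
have [|u [_ uu]] := sheafP JS (x := fun d f _ => res f a).
  by move=> d e f g h _ _ /(res_heq (p := F)) ->; rewrite res_comp.
by rewrite -(uu a) // (uu b) // => d f Sf; rewrite ab.
Qed.

Lemma sheaf_glue (C : category) (J : forall c : C, sieve c -> Prop) (F : sheaf J)
    (c : C) (S : sieve c) (x : forall d (f : hom d c), S d f -> F d) :
  J c S -> matching x -> exists a, forall d f (Sf : S d f), res f a = x d f Sf.
Proof. by move=> JS mx; have [a [aP _]] := sheafP JS mx; exists a. Qed.

Definition res_stable (C : category) (F : presheaf C) (P : forall c, F c -> Prop) :=
  forall (c d : C) (f : hom d c) x, P c x -> P d (res f x).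

Definition local (C : category) (J : forall c : C, sieve c -> Prop) (F : presheaf C)
    (P : forall c, F c -> Prop) :=
  forall (c : C) (S : sieve c) x, J c S ->
    (forall d (f : hom d c), S d f -> P d (res f x)) -> P c x.

Lemma sig_eq (A : Type) (P : A -> Prop) (x y : {a | P a}) : sval x = sval y -> x = y.
Proof.
case: x y => [x Px] [y Py] /= e; case: y / e Py => Py.
by rewrite (proof_irrelevance _ Px Py).
Qed.

Definition subpresheaf (C : category) (F : presheaf C) (P : forall c, F c -> Prop)
    (hP : res_stable P) : presheaf C.
Proof.
apply: (@Presheaf C (fun c => {x : F c | P c x})
  (fun c d f x => exist _ (res f (sval x)) (hP c d f _ (proj2_sig x)))).
- by move=> c d f g x e; apply: sig_eq; exact: res_heq.
- by move=> c x; apply: sig_eq; exact: res_id.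
- by move=> c d e f g x; apply: sig_eq; exact: res_comp.
Defined.

(** Sections are glued in [F], and locality puts the result back in [P]. *)
Lemma subsheafP (C : category) (J : forall c : C, sieve c -> Prop) (F : sheaf J)
    (P : forall c, F c -> Prop) (hP : res_stable P) :
  local J P -> is_sheaf J (subpresheaf hP).
Proof.
move=> lP c S JS x mx.
have [|a aP] := sheaf_glue (F := F) (x := fun d f Sf => sval (x d f Sf)) JS.
  by move=> d e f g h Sf Sh' e1; rewrite (mx _ _ _ _ _ Sf Sh' e1).
have Pa : P c a.
  by apply: (lP _ S) => // d f Sf; rewrite (aP _ _ Sf); exact: proj2_sig.
exists (exist _ a Pa); split=> [d f Sf|b bP]; apply: sig_eq => //=.
by apply: (sheaf_sep JS) => d f Sf; rewrite (aP _ _ Sf) -(bP _ _ Sf).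
Qed.

Definition subsheaf (C : category) (J : forall c : C, sieve c -> Prop) (F : sheaf J)
    (P : forall c, F c -> Prop) (hP : res_stable P) (lP : local J P) : sheaf J :=
  Sheaf (@subsheafP _ _ F P hP lP).

Definition subsheaf_incl (C : category) (J : forall c : C, sieve c -> Prop)
    (F : sheaf J) (P : forall c, F c -> Prop) (hP : res_stable P) (lP : local J P) :
  hom (subsheaf hP lP : Sh J) F :=
  @NatTrans C (subpresheaf hP) F (fun c x => sval x) (fun _ _ _ _ => erefl).

Lemma inj_monic (C : category) (J : forall c : C, sieve c -> Prop)
    (A F : Sh J) (m : hom A F) :
  (forall c, injective (m c)) -> monic m.
Proof. by move=> mI X f g e c x; apply: mI; exact: e. Qed.

Lemma subsheaf_monic (C : category) (J : forall c : C, sieve c -> Prop)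
    (F : sheaf J) (P : forall c, F c -> Prop) (hP : res_stable P) (lP : local J P) :
  monic (subsheaf_incl hP lP).
Proof. by apply: inj_monic => c; exact: sig_eq. Qed.

Definition prod_presheaf (C : category) (F G : presheaf C) : presheaf C.
Proof.
apply: (@Presheaf C (fun c => (F c * G c)%type)
  (fun c d f x => (res f x.1, res f x.2))).
- by move=> c d f g x e; rewrite !(res_heq _ e).
- by move=> c [x y]; rewrite !res_id.
- by move=> c d e f g x; rewrite !res_comp.
Defined.

Lemma prod_sheafP (C : category) (J : forall c : C, sieve c -> Prop) (F G : sheaf J) :
  is_sheaf J (prod_presheaf F G).
Proof.
move=> c S JS x mx.
have [|a aP] := sheaf_glue (F := F) (x := fun d f Sf => (x d f Sf).1) JS.
  by move=> d e f g h Sf Sh' e1; rewrite (mx _ _ _ _ _ Sf Sh' e1).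
have [|b bP] := sheaf_glue (F := G) (x := fun d f Sf => (x d f Sf).2) JS.
  by move=> d e f g h Sf Sh' e1; rewrite (mx _ _ _ _ _ Sf Sh' e1).
exists (a, b); split=> [d f Sf|[a' b'] abP] /=.
  by rewrite (aP _ _ Sf) (bP _ _ Sf); case: (x d f Sf).
congr pair; apply: (sheaf_sep JS) => d f Sf.
  by rewrite (aP _ _ Sf) -(abP _ _ Sf).
by rewrite (bP _ _ Sf) -(abP _ _ Sf).
Qed.

(* Tests the monomorphism against its kernel pair. *)
Lemma monic_inj (C : category) (J : forall c : C, sieve c -> Prop)
    (A F : Sh J) (m : hom A F) :
  monic m -> forall c, injective (m c).
Proof.
move=> mm c a b mab.
pose AA : sheaf J := Sheaf (@prod_sheafP _ _ A A).
pose P c (p : AA c) := m c p.1 = m c p.2.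
have hP : res_stable P by move=> d e f p; rewrite /P /= !naturality => ->.
have lP : local J P.
  move=> d S p JS H; apply: (sheaf_sep JS) => e f Sf.
  by rewrite -!naturality; exact: H Sf.
pose K : Sh J := subsheaf hP lP.
pose k1 : hom K A :=
  @NatTrans C (subpresheaf hP) A (fun c x => (sval x).1) (fun _ _ _ _ => erefl).
pose k2 : hom K A :=
  @NatTrans C (subpresheaf hP) A (fun c x => (sval x).2) (fun _ _ _ _ => erefl).
have /(_ c (exist _ (a, b) mab)) // : heq k1 k2.
by apply: mm => d [p pP].
Qed.

(** * Subobjects compared through their images *)

Definition in_img (C : category) (J : forall c : C, sieve c -> Prop)
    (A F : Sh J) (m : hom A F) (c : C) (x : (F : sheaf J) c) : Prop :=
  exists a, m c a = x.

Lemma in_img_res (C : category) (J : forall c : C, sieve c -> Prop)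
    (A F : Sh J) (m : hom A F) : res_stable (in_img m).
Proof. by move=> c d f _ [a <-]; exists (res f a); rewrite naturality. Qed.

(** Preimages are chosen along the cover; injectivity of [m] makes them match, so they glue to a
    preimage of [x]. *)
Lemma in_img_local (C : category) (J : forall c : C, sieve c -> Prop)
    (A F : Sh J) (m : hom A F) : monic m -> local J (in_img m).
Proof.
move=> /monic_inj mI c S x JS H.
pose y d (f : hom d c) (Sf : S d f) :=
  sval (constructive_indefinite_description _ (H d f Sf)).
have yP d (f : hom d c) (Sf : S d f) : m d (y d f Sf) = res f x.
  by rewrite /y; case: constructive_indefinite_description.
have [|a aP] := sheaf_glue (F := A) (x := y) JS.
  move=> d e f g h Sf Sh' e1; apply: mI; rewrite naturality !yP -res_comp.
  exact: res_heq.
exists a; apply: (sheaf_sep JS) => d f Sf.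
by rewrite -naturality (aP _ _ Sf) yP.
Qed.

(** From an inclusion of images, the factorization is obtained by choosing preimages under [n];
    injectivity of [n] makes the choice natural. *)
Lemma sub_leP (C : category) (J : forall c : C, sieve c -> Prop)
    (A B F : Sh J) (m : hom A F) (n : hom B F) : monic n ->
  sub_le m n <-> forall c x, in_img m (c := c) x -> in_img n (c := c) x.
Proof.
move=> /monic_inj nI; split=> [[k kP] c x [a <-]|H].
  by exists (k c a); exact: kP.
have H' c a : exists b, n c b = m c a by apply: H; exists a.
pose k c a := sval (constructive_indefinite_description _ (H' c a)).
have kP c a : n c (k c a) = m c a.
  by rewrite /k; case: constructive_indefinite_description.
have kN c d (f : hom d c) a : k d (res f a) = res f (k c a).
  by apply: nI; rewrite naturality !kP naturality.
by exists (NatTrans kN) => c a; exact: kP.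
Qed.

Lemma in_img_subsheaf (C : category) (J : forall c : C, sieve c -> Prop)
    (F : sheaf J) (P : forall c, F c -> Prop) (hP : res_stable P) (lP : local J P)
    c x : in_img (subsheaf_incl hP lP) (c := c) x <-> P c x.
Proof. by split=> [[[a Pa] <-]|Px]; [|exists (exist _ x Px)]. Qed.

(** * Excluded middle and Booleanness *)

Definition empty_sieve (C : category) (c : C) : sieve c :=
  @Sieve C c (fun _ _ => False) (fun _ _ _ _ h => h) (fun _ _ _ _ h => h).

Definition pred_sieve (C : category) (F : presheaf C) (P : forall c, F c -> Prop)
    (hP : res_stable P) (c : C) (x : F c) : sieve c.
Proof.
exists (fun d (f : hom d c) => P d (res f x)).
- by move=> d f g /(res_heq (p := F)) ->.
- by move=> d e f g; rewrite res_comp; exact: hP.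
Defined.

Lemma pull_pred_sieve (C : category) (F : presheaf C) (P : forall c, F c -> Prop)
    (hP : res_stable P) (c d e : C) (f : hom d c) (g : hom e d) (x : F c) :
  pull_sieve f (pred_sieve hP x) e g <-> pred_sieve hP (res f x) e g.
Proof. by rewrite /= res_comp. Qed.

Lemma pred_sieve_id (C : category) (F : presheaf C) (P : forall c, F c -> Prop)
    (hP : res_stable P) (c : C) (x : F c) :
  P c x -> pred_sieve hP x c (idm c).
Proof. by rewrite /= res_id. Qed.

Definition fsub_obj (Sg : signature) (T : theory Sg) (X : syn_cat T)
    (p : form (fctx X)) : syn_cat T := FObj (And (fform X) p).

Lemma fsub_obj_le (Sg : signature) (T : theory Sg) (X : syn_cat T)
    (p : form (fctx X)) :
  prov T (fform (fsub_obj p)) (fsub (fform X) idsub).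
Proof. by rewrite fsub_id; exact: p_andl. Qed.

Definition fsub_incl (Sg : signature) (T : theory Sg) (X : syn_cat T)
    (p : form (fctx X)) : hom (fsub_obj p) X := term_arrow (fsub_obj_le p).

Lemma lem_boolean (Sg : signature) (T : theory Sg) :
  (forall G (a : form G), prov T Top (Or a (Neg T a))) -> boolean_theory T.
Proof.
move=> lem F A m mm.
(* The candidate complement: sections whose restrictions fall into [A] only over empty objects. *)
pose P c x := forall d (f : hom d c), in_img m (res f x) -> prov T (fform d) Bot.
have hP : res_stable P.
  by move=> c d f x Px e g; rewrite -res_comp; exact: Px.
have lP : local (@syn_top Sg T) P.
  move=> c S x JS H d f fx; apply: (cover_bot (syn_top_pull f JS)) => e g Sg'.
  apply: (H _ _ Sg' _ (idm e)); rewrite res_id res_comp; exact: in_img_res fx.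
exists (subsheaf hP lP), (subsheaf_incl hP lP); split.
  exact: (@subsheaf_monic _ _ F P hP lP).
split=> X k kM.
  move=> /(sub_leP _ mm) km /(sub_leP _ (@subsheaf_monic _ _ F P hP lP)) kn Y l lM.
  apply/(sub_leP _ lM) => c x kx.
  have /in_img_subsheaf Px := kn _ _ kx.
  (* A section in both subobjects lives over an empty object. That object is covered by the empty
     sieve, so locality puts the section in every subobject. *)
  have c0 : prov T (fform c) Bot.
    by apply: (Px _ (idm c)); rewrite res_id; exact: km.
  exact: (in_img_local lM (syn_top_bot (empty_sieve c) c0)).
move=> /(sub_leP _ kM) mk /(sub_leP _ kM) nk Y l lM; apply/(sub_leP _ kM) => c x _.
(* For the join it suffices that the arrows restricting [x] into one of the two subobjects cover
   [c]. *)
pose PQ d (y : F d) := in_img m y \/ P d y.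
have hPQ : res_stable PQ.
  by move=> d e f y [/in_img_res|/hP] fy; [left|right].
apply: (in_img_local kM (S := pred_sieve hPQ x)); last first.
  by move=> d f [/mk|fx] //; apply: nk; apply/in_img_subsheaf.
(* Excluded middle is applied to the part of [c] over which [x] restricts into [A]. *)
apply/syn_topP; pose S1 := pred_sieve (in_img_res (m := m)) x.
apply: (prov_orE (prov_top _ (lem _ (img S1)))).
  apply: p_cut (p_andr _ _ _) _; apply: img_le => d f fx.
  by apply: img_ge; left.
apply: (join_elim (p_andr _ _ _)) => h hS1.
(* The part of [c] cut out by [h] is included in [c] by an arrow that restricts [x] into [P]: an
   arrow into this part that restricts [x] into [A] has its values in both [h] and [img S1], so its
   domain is empty. *)
rewrite -[img (pred_sieve hPQ x)]fsub_id.
apply: (img_intro (f := fsub_incl (X := c) (emb h)) (x := idsub)).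
  right=> d g; rewrite -res_comp => gx.
  have hd := p_id T (fform d); rewrite -{2}[fform d]fsub_id in hd.
  apply: (graph_ex (f := g) hd) => r h1 h2; rewrite fsub_bot.
  apply: (prov_sub_bot _ hS1) => /=; apply: p_and.
    exact: prov_snd (graph_cod h2).
  apply: (img_intro (S := S1) (f := comp (fsub_incl (X := c) (emb h)) g) gx).
  apply: comp_graphI (h2) _; apply/term_arrowP; rewrite !subE.
  by split; [exact: graph_cod h2 | exact: Eqs_refl].
apply/term_arrowP; rewrite !subE; split; last exact: Eqs_refl.
apply: p_and (p_andr _ _ _); exact: p_cut (p_andl _ _ _) (p_andl _ _ _).
Qed.

(** * The subobject classifier *)

(** The inverse image of the subobject [p] along [f], as a formula over [X]. *)
Definition fpull (Sg : signature) (T : theory Sg) (X Y : syn_cat T) (f : hom X Y)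
    (p : form (fctx Y)) : form (fctx X) :=
  Exs (And (graph f) (fsub p (inl_sub (fctx Y) (fctx X)))).

Lemma fpullI (Sg : signature) (T : theory Sg) (X Y : syn_cat T) (f : hom X Y)
    (p : form (fctx Y)) E (r : form E) x y :
  prov T r (fsub (graph f) (vcat y x)) -> prov T r (fsub p y) ->
  prov T r (fsub (fpull f p) x).
Proof. by move=> hf hp; apply: (ExsI (u := y)); rewrite /= !subE; exact: p_and. Qed.

Lemma fpullE (Sg : signature) (T : theory Sg) (X Y : syn_cat T) (f : hom X Y)
    (p : form (fctx Y)) E (r q : form E) x :
  let w := inr_sub (fctx Y) E in
  let y := inl_sub (fctx Y) E in
  prov T r (fsub (fpull f p) x) ->
  (forall r', prov T r' (fsub r w) ->
   prov T r' (fsub (graph f) (vcat y (scomp w x))) -> prov T r' (fsub p y) ->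
   prov T r' (fsub q w)) ->
  prov T r q.
Proof.
move=> w y h k; apply: ExsE h _ => r' h1; rewrite /= /lift !subE => h2.
by apply: k => //; [exact: prov_fst h2 | exact: prov_snd h2].
Qed.

Lemma fpull_at (Sg : signature) (T : theory Sg) (X Y : syn_cat T) (f : hom X Y)
    (p : form (fctx Y)) E (r : form E) x y :
  prov T r (fsub (graph f) (vcat y x)) -> prov T r (fsub (fpull f p) x) ->
  prov T r (fsub p y).
Proof.
move=> hf hp; apply: (fpullE hp) => r' h1 h2 h3; rewrite fsub_comp.
have := prov_wk h1 hf; rewrite fsub_comp scomp_vcat => h4.
exact: prov_leib (graph_eq h2 h4) h3.
Qed.

Lemma fpull_dom (Sg : signature) (T : theory Sg) (X Y : syn_cat T) (f : hom X Y)
    (p : form (fctx Y)) : prov T (fpull f p) (fform X).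
Proof.
apply: form_le => E r x h; apply: (fpullE h) => r' _ h2 _.
by rewrite fsub_comp; exact: graph_dom h2.
Qed.

Lemma fpull_mono (Sg : signature) (T : theory Sg) (X Y : syn_cat T) (f : hom X Y)
    (p q : form (fctx Y)) :
  prov T p q -> prov T (fpull f p) (fpull f q).
Proof.
move=> pq; apply: form_le => E r x h; apply: (fpullE h) => r' _ h2 h3.
by rewrite fsub_comp; apply: fpullI h2 (prov_wk h3 pq).
Qed.

Lemma fpull_heq (Sg : signature) (T : theory Sg) (X Y : syn_cat T) (f g : hom X Y)
    (p : form (fctx Y)) :
  heq f g -> prov T (fpull f p) (fpull g p).
Proof.
move=> [fg _]; apply: form_le => E r x h; apply: (fpullE h) => r' _ h2 h3.
by rewrite fsub_comp; apply: fpullI h3; apply: prov_wk h2 fg.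
Qed.

Lemma fpull_id (Sg : signature) (T : theory Sg) (X : syn_cat T) (p : form (fctx X)) :
  prov T p (fform X) -> prov_equiv T (fpull (idm X) p) p.
Proof.
move=> pX; split; apply: form_le => E r x h.
  apply: (fpullE h) => r' _ /arrow_idP [_ h2] h3; rewrite fsub_comp.
  exact: prov_leib h2 h3.
apply: (fpullI (y := x) _ h); apply/arrow_idP.
by split; [exact: prov_wk h pX | exact: Eqs_refl].
Qed.

Lemma fpull_comp (Sg : signature) (T : theory Sg) (X Y Z : syn_cat T)
    (f : hom Y Z) (g : hom X Y) (p : form (fctx Z)) :
  prov_equiv T (fpull (comp f g) p) (fpull g (fpull f p)).
Proof.
split; apply: form_le => E r x h; apply: (fpullE h) => r1 h1 h2 h3.
  rewrite fsub_comp; apply: (comp_graphE h2) => w y r2 h4 h5 h6.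
  rewrite fsub_comp; apply: fpullI h5 _; apply: fpullI h6 _.
  by have := prov_wk h4 h3; rewrite fsub_comp.
apply: (fpullE h3) => r2 h4 h5 h6; rewrite fsub_comp fsub_comp.
have := prov_wk h4 h2; rewrite !subE => h7.
by rewrite ?subE; apply: fpullI h6; apply: comp_graphI h7 h5.
Qed.

(** * Omega as classes of formulas *)

Definition closed (Sg : signature) (T : theory Sg) (X : fobj Sg)
    (P : reg (fctx X) -> Prop) :=
  (forall h, prov T (emb h) (join P) -> P h) /\ prov T (join P) (fform X).

(** Formulas below [fform X] modulo provable equivalence, each class represented by the set of all
    regular formulas below it. This keeps the values of the sheaf small and makes equality of
    classes an actual equality. *)
Definition Om (Sg : signature) (T : theory Sg) (X : fobj Sg) : SET :=
  {P : reg (fctx X) -> Prop | closed T P}.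

Definition rep (Sg : signature) (T : theory Sg) (X : fobj Sg) (a : Om T X) :
  form (fctx X) := join (sval a).

Lemma rep_dom (Sg : signature) (T : theory Sg) (X : fobj Sg) (a : Om T X) :
  prov T (rep a) (fform X).
Proof. by case: a => P []. Qed.

(** A closed set contains every regular formula below its join, so equivalent joins come from the
    same set. *)
Lemma rep_inj (Sg : signature) (T : theory Sg) (X : fobj Sg) (a b : Om T X) :
  prov_equiv T (rep a) (rep b) -> a = b.
Proof.
case: a b => [P [cP dP]] [Q [cQ dQ]] [/= ab ba]; apply: sig_eq => /=.
apply: functional_extensionality => h; apply: propositional_extensionality.
split=> [Ph|Qh]; first exact: (cQ h (p_cut (join_ge Ph) ab)).
exact: (cP h (p_cut (join_ge Qh) ba)).
Qed.

Lemma cls_closed (Sg : signature) (T : theory Sg) (X : fobj Sg)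
    (p : form (fctx X)) :
  closed T (fun h => prov T (emb h) (And (fform X) p)).
Proof.
split=> [h|]; last by apply: join_le => h; exact: prov_fst.
by move=> hp; apply: p_cut hp _; apply: join_le.
Qed.

Definition cls (Sg : signature) (T : theory Sg) (X : fobj Sg) (p : form (fctx X)) :
  Om T X := exist _ _ (cls_closed T p).

Lemma rep_cls (Sg : signature) (T : theory Sg) (X : fobj Sg) (p : form (fctx X)) :
  prov_equiv T (rep (cls T p)) (And (fform X) p).
Proof. by split; [apply: join_le | exact: reg_dense]. Qed.

Lemma rep_cls_le (Sg : signature) (T : theory Sg) (X : fobj Sg)
    (p : form (fctx X)) :
  prov T p (fform X) -> prov_equiv T (rep (cls T p)) p.
Proof.
move=> pX; have [h1 h2] := rep_cls T p; split; first exact: prov_snd h1.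
by apply: p_cut h2; apply: p_and pX (p_id _ _).
Qed.

Definition Om_res (Sg : signature) (T : theory Sg) (X Y : syn_cat T) (f : hom Y X)
    (a : Om T X) : Om T Y := cls T (fpull f (rep a)).

Lemma rep_res (Sg : signature) (T : theory Sg) (X Y : syn_cat T) (f : hom Y X)
    (a : Om T X) : prov_equiv T (rep (Om_res f a)) (fpull f (rep a)).
Proof. by apply: rep_cls_le; exact: fpull_dom. Qed.

Lemma prov_equiv_sym (Sg : signature) (T : theory Sg) (G : ctx Sg) (p q : form G) :
  prov_equiv T p q -> prov_equiv T q p.
Proof. by case. Qed.

Lemma prov_equiv_trans (Sg : signature) (T : theory Sg) (G : ctx Sg)
    (p q r : form G) :
  prov_equiv T p q -> prov_equiv T q r -> prov_equiv T p r.
Proof. by move=> [? ?] [? ?]; split; apply: p_cut; eassumption. Qed.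

Definition Om_presheaf (Sg : signature) (T : theory Sg) : presheaf (syn_cat T).
Proof.
apply: (@Presheaf (syn_cat T) (Om T) (fun X Y f => Om_res f)).
- move=> X Y f g a fg; apply: rep_inj.
  apply: prov_equiv_trans (rep_res f a) _; apply: prov_equiv_sym.
  apply: prov_equiv_trans (rep_res g a) _.
  by split; apply: fpull_heq => //; exact: heq_sym.
- move=> X a; apply: rep_inj; apply: prov_equiv_trans (rep_res _ _) _.
  by apply: fpull_id; exact: rep_dom.
- move=> X Y Z f g a; apply: rep_inj.
  apply: prov_equiv_trans (rep_res _ _) _.
  apply: prov_equiv_trans (fpull_comp _ _ _) _; apply: prov_equiv_sym.
  apply: prov_equiv_trans (rep_res _ _) _.
  by have [? ?] := rep_res f a; split; apply: fpull_mono.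
Defined.

Lemma res_Om (Sg : signature) (T : theory Sg) (X Y : syn_cat T) (f : hom Y X)
    (a : Om_presheaf T X) (b : Om_presheaf T Y) :
  res f a = b <-> prov_equiv T (fpull f (rep a)) (rep b).
Proof.
split=> [<-|ab]; first by apply: prov_equiv_sym; exact: rep_res.
by apply: rep_inj; apply: prov_equiv_trans (rep_res _ _) ab.
Qed.

(** * Gluing sections of Omega *)

Definition fimg (Sg : signature) (T : theory Sg) (X Y : syn_cat T) (f : hom X Y)
    (p : form (fctx X)) : form (fctx Y) :=
  image (And (graph f) (fsub p (inr_sub (fctx Y) (fctx X)))).

Lemma fimgI (Sg : signature) (T : theory Sg) (X Y : syn_cat T) (f : hom X Y)
    (p : form (fctx X)) E (r : form E) x y :
  prov T r (fsub (graph f) (vcat y x)) -> prov T r (fsub p x) ->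
  prov T r (fsub (fimg f p) y).
Proof. by move=> hf hp; apply: (imageI (x := x)); rewrite /= !subE; exact: p_and. Qed.

Lemma fimgE (Sg : signature) (T : theory Sg) (X Y : syn_cat T) (f : hom X Y)
    (p : form (fctx X)) E (r q : form E) y :
  let w := inr_sub (fctx X) E in
  let x := inl_sub (fctx X) E in
  prov T r (fsub (fimg f p) y) ->
  (forall r', prov T r' (fsub r w) ->
   prov T r' (fsub (graph f) (vcat (scomp w y) x)) -> prov T r' (fsub p x) ->
   prov T r' (fsub q w)) ->
  prov T r q.
Proof.
move=> w x h k; apply: imageE h _ => r' h1; rewrite /= !subE => h2.
by apply: k => //; [exact: prov_fst h2 | exact: prov_snd h2].
Qed.

(** Since [f x] and [g y] agree, [(x, y)] is a point of the fibre product, where both sections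
    restrict to the same section; truth passes from [x] to [(x, y)] and then to [y]. *)
Lemma matching_transfer (Sg : signature) (T : theory Sg) (Z : syn_cat T)
    (S : sieve Z) (a : forall X (f : hom X Z), S X f -> Om_presheaf T X)
    (X Y : syn_cat T) (f : hom X Z) (g : hom Y Z) (Sf : S X f) (Sg' : S Y g)
    E (r : form E) x y z :
  matching a ->
  prov T r (fsub (graph f) (vcat z x)) -> prov T r (fsub (graph g) (vcat z y)) ->
  prov T r (fsub (rep (a X f Sf)) x) -> prov T r (fsub (rep (a Y g Sg')) y).
Proof.
move=> ma hf hg hx.
pose p1 : hom (pb_obj f g : syn_cat T) X := pb_fst f g.
pose p2 : hom (pb_obj f g : syn_cat T) Y := pb_snd f g.
have Sh' := sieve_comp p1 Sf.
have /esym/res_Om e1 := ma _ _ f p1 _ Sf Sh' (heq_refl _).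
have /esym/res_Om e2 := ma _ _ g p2 _ Sg' Sh' (pb_comm f g).
have hv := pb_objI hf hg.
have h1 : prov T r (fsub (graph p1) (vcat x (vcat x y))).
  by apply/term_arrowP; rewrite !subE; split=> //; exact: Eqs_refl.
have h2 : prov T r (fsub (graph p2) (vcat y (vcat x y))).
  by apply/term_arrowP; rewrite !subE; split=> //; exact: Eqs_refl.
apply: fpull_at h2 _; apply: prov_wk (proj2 e2); apply: prov_wk (proj1 e1).
exact: fpullI h1 hx.
Qed.

Lemma fpull_sep (Sg : signature) (T : theory Sg) (Z : syn_cat T) (S : sieve Z)
    (p q : form (fctx Z)) :
  syn_top S -> prov T p (fform Z) ->
  (forall (X : syn_cat T) (f : hom X Z), S X f -> prov T (fpull f p) (fpull f q)) ->
  prov T p q.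
Proof.
move=> /syn_topP SZ pZ H; apply: form_le => E r z hz.
apply: (img_elim (prov_wk (prov_wk hz pZ) SZ)) => X f E' r' w x Sf h1 h2.
rewrite fsub_comp; apply: fpull_at (h2) _; apply: prov_wk (H _ _ Sf).
by apply: fpullI h2 _; rewrite -fsub_comp; exact: p_cut h1 (p_sub _ hz).
Qed.

Lemma Om_sheafP (Sg : signature) (T : theory Sg) :
  is_sheaf (@syn_top Sg T) (Om_presheaf T).
Proof.
move=> Z S JS a ma.
(* The gluing is the union of the direct images of all given sections, written with regular formulas
   because the sieve is large. *)
pose q := join (fun h => exists (X : syn_cat T) (f : hom X Z) (Sf : S X f),
  prov T (emb h) (fimg f (rep (a X f Sf)))).
have qZ : prov T q (fform Z).
  apply: join_le => h [X [f [Sf hf]]]; apply: p_cut hf _.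
  apply: form_le => E r z hz; apply: (fimgE hz) => r' _ h1 _.
  by rewrite fsub_comp; exact: graph_cod h1.
have qP X (f : hom X Z) (Sf : S X f) :
    prov_equiv T (fpull f q) (rep (a X f Sf)).
  split; apply: form_le => E r x hx.
    (* A point [x] with [f x] in [q] has [f x] equal to some [g y] with [y] in the section at [g];
       matching moves this to the section at [f]. *)
    apply: (fpullE hx) => r1 h1 h2 h3.
    apply: (prov_disjE h3) => -[h [Y [g [Sg' hg]]]].
    apply: (fimgE (prov_wk (p_andr _ _ _) hg)) => r2 h4 h5 h6.
    rewrite /= in h4; have := prov_wk (prov_fst h4) h2.
    rewrite !subE in h5 * => h7.
    exact: matching_transfer ma h5 h7 h6.
  apply: (graph_ex (f := f) (prov_wk hx (rep_dom _))) => r1 h1 h2.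
  rewrite fsub_comp; apply: fpullI (h2) _.
  have hq : prov T (fimg f (rep (a X f Sf))) q.
    by apply: reg_le => h hf; apply: join_ge; exists X, f, Sf.
  apply: prov_wk hq; apply: fimgI h2 _.
  by rewrite -fsub_comp; exact: p_cut h1 (p_sub _ hx).
have [cq qc] := rep_cls_le qZ.
exists (cls T q); split=> [X f Sf|b bP].
  apply/res_Om; apply: prov_equiv_trans (qP _ _ _).
  by split; exact: fpull_mono.
apply: rep_inj.
have H X (f : hom X Z) : S X f ->
    prov_equiv T (fpull f (rep (cls T q))) (fpull f (rep b)).
  move=> Sf; have /res_Om bf := bP _ _ Sf.
  apply: prov_equiv_trans (prov_equiv_sym bf).
  by apply: prov_equiv_trans (qP _ _ _); split; exact: fpull_mono.
split; apply: (fpull_sep JS (rep_dom _)) => X f /H [] //.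
Qed.

Definition Om_sheaf (Sg : signature) (T : theory Sg) : classifying_topos T :=
  Sheaf (@Om_sheafP Sg T).

(** * The truth arrow and complements of formulas *)

Definition one_presheaf (C : category) : presheaf C.
Proof.
by apply: (@Presheaf C (fun _ => unit) (fun _ _ _ x => x)).
Defined.

Lemma one_sheafP (C : category) (J : forall c : C, sieve c -> Prop) :
  is_sheaf J (one_presheaf C).
Proof.
move=> c S JS x mx; exists tt; split=> [d f Sf|[] //].
by case: (x d f Sf).
Qed.

Definition one_sheaf (Sg : signature) (T : theory Sg) : classifying_topos T :=
  Sheaf (@one_sheafP (syn_cat T) (@syn_top Sg T)).

Lemma fpull_total (Sg : signature) (T : theory Sg) (X Y : syn_cat T) (f : hom X Y)
    (p : form (fctx Y)) :
  prov T (fform X) (fpull f p) <-> prov T (image (graph f)) p.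
Proof.
split=> H; apply: form_le => E r.
  move=> y hy; apply: (imageE hy) => r' _ h2; rewrite fsub_comp.
  exact: fpull_at h2 (prov_wk (graph_dom h2) H).
move=> x hx; apply: (graph_ex (f := f) hx) => r' _ h2.
by rewrite fsub_comp; apply: fpullI (h2) (prov_wk (imageI h2) H).
Qed.

Lemma cls_top_eq (Sg : signature) (T : theory Sg) (X : syn_cat T) (a : Om T X) :
  cls T Top = a <-> prov T (fform X) (rep a).
Proof.
have [h1 h2] := rep_cls T (X := X) Top.
have topX : prov T (fform X) (rep (cls T (X := X) Top)).
  by apply: p_cut h2; apply: p_and (p_id _ _) (p_top _ _).
split=> [<- //|Xa]; apply: rep_inj; split; last exact: p_cut (rep_dom _) topX.
exact: p_cut (rep_dom _) Xa.
Qed.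

Lemma true_natural (Sg : signature) (T : theory Sg) (X Y : syn_cat T)
    (f : hom Y X) : cls T Top = res f (cls T Top : Om_presheaf T X).
Proof.
apply/cls_top_eq; have [_ h] := rep_res f (cls T (X := X) Top).
apply: p_cut h; apply/fpull_total.
apply: (p_cut (q := fform X)); last by apply/cls_top_eq.
rewrite -[image _]fsub_id -[fform X]fsub_id.
apply: (imageE (p_id _ _)) => r' _ h2; rewrite fsub_comp.
exact: graph_cod h2.
Qed.

Definition true_arrow (Sg : signature) (T : theory Sg) :
    hom (one_sheaf T) (Om_sheaf T) :=
  @NatTrans (syn_cat T) (one_presheaf (syn_cat T)) (Om_presheaf T)
    (fun X _ => cls T Top) (fun X Y f _ => true_natural f).

(* The complement of [true : 1 -> Omega], pulled back along the section of Omega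
   given by a formula, is a complement of that formula. *)
Lemma boolean_complement (Sg : signature) (T : theory Sg) (G : ctx Sg)
    (a : form G) :
  boolean_theory T ->
  exists b, prov T (And a b) Bot /\ prov T Top (Or a b).
Proof.
move=> bT.
have mM : monic (true_arrow T) by move=> X f g _ c x; case: (f c x) (g c x) => [] [].
have [B [n [nM [meet0 join1]]]] := bT _ _ _ mM.
set m := true_arrow T in mM meet0 join1.
(* The meet condition is tested on the intersection [P] of the two images, against the subsheaf [Q]
   of sections over empty objects. *)
have disj X (x : Om_presheaf T X) :
    in_img m (c := X) x -> in_img n (c := X) x -> prov T (fform X) Bot.
  pose P c (x : Om_presheaf T c) := in_img m (c := c) x /\ in_img n (c := c) x.
  have hP : res_stable P.
    by move=> c d f y [h1 h2]; split;
      [exact: (@in_img_res _ _ _ _ m) | exact: (@in_img_res _ _ _ _ n)].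
  have lP : local (@syn_top Sg T) P.
    move=> c S y JS H; split.
      by apply: (in_img_local mM JS) => d f /H [].
    by apply: (in_img_local nM JS) => d f /H [].
  pose Q c (x : Om_presheaf T c) := prov T (fform c) Bot.
  have hQ : res_stable Q by move=> c d f y; exact: arrow_bot.
  have lQ : local (@syn_top Sg T) Q by move=> c S y JS H; exact: cover_bot JS H.
  have kM := @subsheaf_monic _ _ (Om_sheaf T) P hP lP.
  have lM := @subsheaf_monic _ _ (Om_sheaf T) Q hQ lQ.
  have /(sub_leP _ lM) H := meet0 _ _ kM
    (proj2 (sub_leP _ mM) (fun c x h =>
       proj1 (proj1 (in_img_subsheaf (F := Om_sheaf T) hP lP x) h)))
    (proj2 (sub_leP _ nM) (fun c x h =>
       proj2 (proj1 (in_img_subsheaf (F := Om_sheaf T) hP lP x) h)))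
    _ _ lM.
  move=> mx nx.
  have /(H X)/in_img_subsheaf // : in_img (subsheaf_incl (F := Om_sheaf T) hP lP)
    (c := X) x by apply/in_img_subsheaf.
pose PQ c (x : Om_presheaf T c) := in_img m (c := c) x \/ in_img n (c := c) x.
have hPQ : res_stable PQ.
  by move=> c d f y [h|h]; [left | right];
    [exact: (@in_img_res _ _ _ _ m) | exact: (@in_img_res _ _ _ _ n)].
(* The union of the two images need not be local, so the join condition is tested on its closure
   [Q], the sections that lie in the union on a cover. [Q] must then be all of Omega. *)
have cov X (x : Om_presheaf T X) : syn_top (pred_sieve hPQ x).
  pose Q c (x : Om_presheaf T c) := syn_top (pred_sieve hPQ x).
  have hQ : res_stable Q.
    move=> c d f y /(syn_top_pull f); apply: syn_top_mono => e g.
    exact: proj1 (pull_pred_sieve _ _ _ _).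
  have lQ : local (@syn_top Sg T) Q.
    move=> c S y JS H; apply: (syn_top_trans JS) => d f /H.
    apply: syn_top_mono => e g; exact: proj2 (pull_pred_sieve _ _ _ _).
  have kM := @subsheaf_monic _ _ (Om_sheaf T) Q hQ lQ.
  have PQk c (y : Om_presheaf T c) : PQ c y ->
      in_img (subsheaf_incl (F := Om_sheaf T) hQ lQ) (c := c) y.
    move=> y1; apply/in_img_subsheaf; apply: syn_top_id.
    exact: pred_sieve_id.
  have idM : monic (idm (Om_sheaf T)) by apply: inj_monic => c u v.
  have /(sub_leP _ kM) H := join1 _ _ kM
    (proj2 (sub_leP _ kM) (fun c y h => PQk c y (or_introl h)))
    (proj2 (sub_leP _ kM) (fun c y h => PQk c y (or_intror h)))
    _ _ idM.
  have idx : in_img (idm (Om_sheaf T)) (c := X) x by exists x.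
  exact: proj1 (in_img_subsheaf (F := Om_sheaf T) hQ lQ x) (H X x idx).
pose X : syn_cat T := FObj (Top : form G).
pose x : Om_presheaf T X := cls T (X := X) a.
have [xa ax] := rep_cls T (X := X) a.
have {}xa : prov T (rep x) a by exact: prov_snd xa.
have {}ax : prov T a (rep x) by apply: p_cut ax; apply: p_and (p_top _ _) (p_id _ _).
have imgP Y (y : Om_presheaf T Y) : in_img m (c := Y) y <-> prov T (fform Y) (rep y).
  by split=> [[_ /cls_top_eq]|/cls_top_eq <-] //; exists tt.
(* The complement of [a] is the part of the context over which its section [x] restricts into the
   complement [n] of truth. *)
exists (img (pred_sieve (@in_img_res _ _ _ _ n) x)); split.
  have ba Y (f : hom Y X) : in_img n (c := Y) (res f x) ->
      prov T (And a (image (graph f))) Bot.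
    (* Over the inverse image of [a] along [f] the section becomes true while remaining in [n], so
       by [disj] this inverse image is empty. *)
    move=> nf; pose j := fsub_incl (fpull f (a : form (fctx X))).
    have j0 : prov T (fform (fsub_obj (fpull f (a : form (fctx X))))) Bot.
      apply: (disj _ (res j (res f x)));
        last exact: (@in_img_res _ _ _ _ n _ _ j) nf.
      apply/imgP; apply: p_cut (proj2 (rep_res _ _)); apply/fpull_total.
      apply: p_cut (proj2 (rep_res _ _)); apply: p_cut (fpull_mono f ax).
      apply: form_le => E r y hy; apply: (imageE hy) => r' _ /term_arrowP [h1 h2].
      rewrite fsub_comp; rewrite scomp_idr in h2.
      exact: prov_leib (Eqs_sym h2) (prov_snd h1).
    have hX := p_andr T a (image (graph f)); rewrite -{2}[image _]fsub_id in hX.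
    apply: (imageE hX) => r h1 h2; rewrite fsub_bot; rewrite scomp_idr in h2.
    apply: prov_sub_bot j0 => /=; apply: p_and; first exact: graph_dom h2.
    by apply: fpullI h2 _; exact: prov_fst h1.
  apply: (join_elim (p_andr _ _ _)) => h [Y [f [nf hf]]].
  apply: p_cut (ba _ _ nf); apply: p_and; last exact: p_cut (p_andr _ _ _) hf.
  exact: p_cut (p_andl _ _ _) (p_andl _ _ _).
apply: (cover_le (cov X x)) => Y f [mf|nf].
  apply: p_cut (prov_orl _ _ _); apply: p_cut xa.
  by apply/fpull_total; apply: p_cut (proj1 (rep_res _ _)); apply/imgP.
by apply: p_cut (prov_orr _ _ _); exact: img_ge.
Qed.

(** * Maximality against Booleanness and completeness *)

Theorem proposition10p12 (Sg : signature) (T T' : theory Sg) (hq : quotient T T') :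
  (~ contradictory T' /\
   forall s : sequent Sg, provable T' s \/ contradictory (add_axiom T' s))
  <->
  (boolean_theory T' /\ complete T').
Proof.
split=> [[nc max]|[bT cT]]; last first.
  have nc : ~ contradictory T'.
    by move=> c; have [_] := cT Top; apply; split; split=> //; exact: p_top.
  split=> // -[G p q]; have [b [qb0 qb1]] := boolean_complement q bT.
  (* [e] says that [p] and the complement of [q] meet, i.e. that the sequent has a counterexample.
     The substitution moves [And p b] to the context [G ++ [::]], which [Exs] closes. *)
  pose e : form [::] := Exs (fsub (And p b) (inl_sub G [::])).
  have [[[_ eT]|[e0 _]] _] := cT e; [right | left].
    (* If the counterexample provably exists, the new axiom sends it into [q] as well as [b], which
       are disjoint. *)
    have sT s : T' s -> add_axiom T' (Sequent p q) s by left.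
    apply: p_cut (prov_mono sT eT) _; apply: Exs_le; rewrite fsub_bot.
    apply: prov_sub_bot (p_id _ _) _; apply: p_cut (prov_mono sT qb0).
    apply: p_and (p_andr _ _ _); apply: p_cut (p_andl _ _ _) _.
    exact: (p_ax (T := add_axiom T' (Sequent p q)) (or_intror erefl)).
  (* If no counterexample exists, split on [q] or [b]: the case [b] gives a witness of [e]. *)
  apply: (prov_orE (prov_top _ qb1)) => /=; first exact: p_andr.
  apply: prov_botE; apply: (prov_sub_bot (s := @nosub _ G) _ e0).
  by apply: (ExsI (u := idsub)); rewrite !subE; exact: p_id.
split.
  apply: lem_boolean => G a; case: (max (Sequent Top (Or a (Neg T' a)))) => //.
  (* The inconsistent alternative is ruled out by the closed instance of [nnle] with side formula
     [Top], which would make [T'] contradictory. *)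
  move=> /lem_conservative /(_ [::] idsub Top); rewrite fsub_bot /= => H.
  case: nc; apply: p_cut (H (p_andr _ _ _)).
  by apply: p_and; exact: p_top.
move=> p; split; last first.
  by move=> [[_ h1] [h2 _]]; apply: nc; apply: p_cut h1 h2.
(* Maximality is applied to the axiom asserting [p]; when adding it is contradictory, the deduction
   theorem refutes [p]. *)
case: (max (Sequent Top p)) => h; [left | right]; split=> //.
- exact: p_top.
- have := deduction h; rewrite (sub_nil (@nosub _ _) idsub) fsub_id.
  by apply: p_cut; apply: p_and (p_id _ _) (p_top _ _).
- exact: prov_botE (p_id _ _).
Qed.
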